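(* Let $\mathcal G$ be a compact, connected metric graph, let $\mathcal A=\mathcal A(q,\mathcal B,w,V_0)$ be a Schrödinger operator on $\mathcal G$ as described in the context (in particular $0\le q\in L^1(\mathcal G)$, $\mathcal B$ is Hermitian and generates a positive semigroup $(e^{-t\mathcal B})_{t\ge 0}$), and let $(\psi_n)_{n\in\mathbb N}$ be an arbitrary orthonormal basis of $L^2(\mathcal G)$ consisting of real eigenfunctions of $\mathcal A$, ordered according to the eigenvalues $\lambda_1\le\lambda_2\le\dots$. Let $\nu_n$ be the number of nodal domains of $\psi_n$. Then $$\operatorname{acc}\left\{\tfrac{\nu_n}{n}:n\in\mathbb N\right\}=\operatorname{acc}\left\{\frac{|\{\psi_n\ne0\}|}{|\mathcal G|}:n\in\mathbb N\right\}.$$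
   Context: Metric graph: $\mathcal G$ is obtained from a finite connected combinatorial graph $(V,E)$ (loops and multiple edges allowed) by identifying each edge $e\in E$ with an interval $[0,\ell_e]$ of finite length $\ell_e>0$ and gluing endpoints at the vertices; it carries the path metric and the Lebesgue measure $|\cdot|$, and $|\mathcal G|=\sum_{e\in E}\ell_e$. For $v\in V$, $\deg(v)$ is the number of edge ends at $v$ (a loop counts twice), and for an edgewise $H^1$ function $f$, $f(v)=(f_e(v))_e\in\mathbb C^{\deg(v)}$ is the vector of boundary values of $f$ at the edge ends at $v$. Operator: fix a (possibly empty) set $V_0\subset V$; a potential $0\le q\in L^1(\mathcal G)$; a Hermitian $2|E|\times 2|E|$ matrix $\mathcal B$, with blocks $\mathcal B_{vw}$ of size $\deg(v)\times\deg(w)$ for $v,w\in V$, such that the semigroup $(e^{-t\mathcal B})_{t\ge0}$ is positive (equivalently, all entries of $\mathcal B$ are real and all off-diagonal entries are $\le0$); and weight vectors $w_v=(w_{e,v})_e\in(0,\infty)^{\deg(v)}$, $v\in V\setminus V_0$. Let $H^1_{0,w}(\mathcal G;V_0)$ be the space of edgewise $H^1$ functions $f$ on $\mathcal G$ such that $w_{e,v}f_e(v)=w_{e',v}f_{e'}(v)$ for all edge ends $e,e'$ at each $v\in V\setminus V_0$, and $f(v)=0$ for each $v\in V_0$. The operator $\mathcal A(q,\mathcal B,w,V_0)$ is the self-adjoint operator on $L^2(\mathcal G)$ associated with the closed quadratic form $$a(f)=\int_{\mathcal G}\left(|f'(x)|^2+q(x)|f(x)|^2\right)dx+\sum_{v,w\in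 V}\left(\mathcal B_{vw}f(w),f(v)\right)_{\mathbb C^{\deg(v)}},\qquad D(a)=H^1_{0,w}(\mathcal G;V_0).$$ Its spectrum consists of real eigenvalues $\lambda_1\le\lambda_2\le\dots\to+\infty$, repeated according to their finite multiplicities. Nodal domains of $\psi_n$: the closures in $\mathcal G$ of the connected components of $\{\psi_n\ne0\}$. (At each vertex the boundary values of $\psi_n$ along the incident edge ends are either all zero or all nonzero of the same sign, so this set is well defined.) For a sequence $(a_n)\subset\mathbb R$, $\operatorname{acc}\{a_n:n\in\mathbb N\}$ is the set of its points of accumulation, i.e. of limits of its convergent subsequences (so a value attained infinitely often counts). *)

(* Defs.v *)
From HB Require Import structures.
From mathcomp Require Import all_boot all_order all_algebra.
From mathcomp Require Import generic_quotient finmap.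
From mathcomp Require Import all_classical all_reals all_analysis.
From mathcomp.real_closed Require Import complex.

Set Implicit Arguments.
Unset Strict Implicit.
Unset Printing Implicit Defensive.

Import Order.TTheory GRing.Theory Num.Theory.
Import numFieldNormedType.Exports.

Local Open Scope classical_set_scope.
Local Open Scope ring_scope.

(** ** Metric graphs *)

(* An edge end is a pair [(e, b) : E * bool]: [(e, false)] is the end of [e] at
   the coordinate [0] and [(e, true)] the end at [ell e].  A loop has two ends
   at its vertex and parallel edges are distinct elements of [E]. *)
Record metric_graph (R : realType) := MetricGraph {
  vertex : finType;
  edge : finType;
  vtx : edge * bool -> vertex;
  ell : edge -> R;
  ell_gt0 : forall e, 0 < ell e;
  vertex_inhabited : (0 < #|vertex|)%N;
  graph_connected : forall v w : vertex,
    connect [rel x y | [exists e, [exists b,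
      (vtx (e, b) == x) && (vtx (e, ~~ b) == y)]]] v w
}.

Section space.
Context {R : realType} (G : metric_graph R).
Local Open Scope quotient_scope.

Definition edge_interval (e : edge G) : set R := `[0, ell e]%classic.

Definition end_coord (i : edge G * bool) : R := if i.2 then ell i.1 else 0.

Definition edge_union := {e : edge G & set_type (edge_interval e)}.

Definition glue_class (x : edge_union) : vertex G + edge_union :=
  let e := projT1 x in
  if set_val (projT2 x) == end_coord (e, false) then inl (vtx (e, false))
  else if set_val (projT2 x) == end_coord (e, true) then inl (vtx (e, true))
  else inr x.

Definition glue_rel (x y : edge_union) := glue_class x == glue_class y.

Local Lemma glue_rel_refl : reflexive glue_rel.
Proof. by move=> x; rewrite /glue_rel. Qed.

Local Lemma glue_rel_sym : symmetric glue_rel.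
Proof. by move=> x y; rewrite /glue_rel eq_sym. Qed.

Local Lemma glue_rel_trans : transitive glue_rel.
Proof. by move=> y x z /eqP xy /eqP yz; rewrite /glue_rel xy yz. Qed.

Definition glue := EquivRel _ glue_rel_refl glue_rel_sym glue_rel_trans.

(* On a finite graph the quotient topology is that of the path metric.  If there
   is no edge, the space is empty instead of a single point; the space L^2 is
   then zero and has no infinite orthonormal sequence. *)
Definition graph_space := {eq_quot glue}.

HB.instance Definition _ :=
  Topological.copy graph_space (quotient_topology graph_space).
HB.instance Definition _ := Quotient.on graph_space.

Definition graph_point (x : edge_union) : graph_space := \pi_graph_space x.

Definition graph_measure (A : set graph_space) : R :=
  fine (\sum_(e : edge G) lebesgue_measure
    (set_val @` [set z : set_type (edge_interval e) |
                 A (graph_point (existT _ e z))]))%E.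

Definition total_length : R := \sum_(e : edge G) ell e.

(* For functions in the form domain, the boundary values along the ends at a
   vertex are all zero or all nonzero, so taking the image is the same as
   requiring nonvanishing at all representatives of a point. *)
Definition nonzero_set (psi : edge G -> R -> R) : set graph_space :=
  graph_point @` [set x | psi (projT1 x) (set_val (projT2 x)) != 0].

Definition nodal_domains (psi : edge G -> R -> R) : set (set graph_space) :=
  [set closure (connected_component (nonzero_set psi) p)
  | p in nonzero_set psi].

(* [fset_set] sends an infinite set to the empty one; eigenfunctions have
   finitely many nodal domains. *)
Definition nodal_count (psi : edge G -> R -> R) : nat :=
  #|` fset_set (nodal_domains psi)|.

End space.

(** ** Complex-valued functions on an interval *)

Section interval.
Context {R : realType}.
Implicit Types (D : set R) (f g : R -> R[i]) (l : R).

Definition Cintegral D f : R[i] :=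
  Complex (\int[lebesgue_measure]_(x in D) complex.Re (f x))
          (\int[lebesgue_measure]_(x in D) complex.Im (f x)).

Definition square_integrable D f : Prop :=
  [/\ measurable_fun D (fun x => complex.Re (f x)),
      measurable_fun D (fun x => complex.Im (f x)) &
      (\int[lebesgue_measure]_(x in D)
         (complex.Re (f x) ^+ 2 + complex.Im (f x) ^+ 2)%:E < +oo)%E].

(* Since [f] is required to be the primitive of [g] at every point, it is the
   continuous representative of its class, so that boundary values and zero sets
   make sense. *)
Definition is_H1_derivative l f g : Prop :=
  square_integrable `[0, l] g /\
  forall x, x \in `[0, l] -> f x = f 0 + Cintegral `[0, x] g.

Definition H1 l f : Prop := exists g, is_H1_derivative l f g.

(* The derivative is unique up to a null set. *)
Definition H1_derivative l f : R -> R[i] :=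
  xget (fun=> 0) [set g | is_H1_derivative l f g].

End interval.

(** ** The semigroup generated by a matrix *)

Definition expmx (C : numFieldType) (n : nat) (A : 'M[C]_n) : 'M[C]_n :=
  lim ((series (fun k => k`!%:R^-1 *: A ^+ k) : nat -> 'M[C]_n) @ \oo).

Definition positive_semigroup (R : realType) (n : nat) (B : 'M[R[i]]_n) : Prop :=
  forall t : R, 0 <= t -> forall x : 'cV[R[i]]_n,
    (forall i, 0 <= x i 0) ->
    forall i, 0 <= (expmx ((- t)%:C%C *: B) *m x) i 0.

(** ** The operator *)

Section operator.
Context {R : realType} (G : metric_graph R).

(* Functions on [G] are given edgewise; only the values of [f e] on
   [0, ell e] matter. *)
Local Notation gfun := (edge G -> R -> R[i]).
Implicit Types f g h : gfun.

Definition boundary_value f (i : edge G * bool) : R[i] := f i.1 (end_coord i).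

Definition edgewise_H1 f : Prop := forall e, H1 (ell e) (f e).

Definition L2 f : Prop :=
  forall e, square_integrable (edge_interval e) (f e).

Definition L2dot f g : R[i] :=
  \sum_(e : edge G) Cintegral (edge_interval e) (fun x => f e x * (g e x)^*).

Variables (q : edge G -> R -> R) (B : 'M[R[i]]_#|{: edge G * bool}|).
Variables (w : edge G * bool -> R) (V0 : {set vertex G}).

Definition form_domain f : Prop :=
  [/\ edgewise_H1 f,
      forall i j, vtx i = vtx j -> vtx i \notin V0 ->
        (w i)%:C%C * boundary_value f i = (w j)%:C%C * boundary_value f j &
      forall i, vtx i \in V0 -> boundary_value f i = 0].

(* The rows and columns of [B] are indexed by the edge ends; its block (u, v)
   consists of the entries at the ends at [u] and at [v]. *)
Definition vertex_form f g : R[i] :=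
  \sum_(u : vertex G) \sum_(v : vertex G)
    \sum_(i | vtx i == u) \sum_(j | vtx j == v)
      B (enum_rank i) (enum_rank j)
        * boundary_value f j * (boundary_value g i)^*.

(* The sesquilinear form whose diagonal is the quadratic form. *)
Definition sesq_form f g : R[i] :=
  \sum_(e : edge G) Cintegral (edge_interval e)
     (fun x => H1_derivative (ell e) (f e) x
                 * (H1_derivative (ell e) (g e) x)^*
               + (q e x)%:C%C * f e x * (g e x)^*)
  + vertex_form f g.

(* [f] is in the domain of the operator associated with the form, and [g] is
   its image. *)
Definition schroedinger f g : Prop :=
  [/\ form_domain f, L2 g &
      forall h, form_domain h -> sesq_form f h = L2dot g h].

Definition of_real (psi : edge G -> R -> R) : gfun :=
  fun e x => (psi e x)%:C%C.

Definition orthonormal_basis (psi : nat -> gfun) : Prop :=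
  [/\ forall n, L2 (psi n),
      forall m n, L2dot (psi m) (psi n) = (m == n)%:R &
      forall f, L2 f ->
        let r n : gfun := fun e x =>
          f e x - \sum_(k < n) L2dot f (psi k) * psi k e x in
        complex.Re (L2dot (r n) (r n)) @[n --> \oo] --> (0 : R)].

Definition ordered_real_eigenbasis
    (lambda : nat -> R) (psi : nat -> edge G -> R -> R) : Prop :=
  [/\ {homo lambda : m n / (m <= n)%N >-> m <= n},
      forall n, schroedinger (of_real (psi n))
                  (fun e x => (lambda n)%:C%C * of_real (psi n) e x) &
      orthonormal_basis (fun n => of_real (psi n))].

End operator.

Definition acc (R : realType) (u : nat -> R) : set R :=
  [set a | exists s : nat -> nat,
     {homo s : m n / (m < n)%N} /\ u (s n) @[n --> \oo] --> a].

(* Main.v *)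
Require Import Defs.
From mathcomp Require Import all_boot all_order all_algebra.
From mathcomp Require Import finmap generic_quotient.
From mathcomp Require Import all_classical all_reals all_analysis.
From mathcomp.real_closed Require Import complex.
From mathcomp Require Import measurable_realfun ring lra.
Set Implicit Arguments.
Unset Strict Implicit.
Unset Printing Implicit Defensive.

Import Order.TTheory GRing.Theory Num.Theory.
Import numFieldNormedType.Exports.

Local Open Scope classical_set_scope.
Local Open Scope ring_scope.

(* Write [s_n] for [sqrt (lambda_n) / pi].  Every error term below is bounded in
   [n], so that [nu_n / (n + 1) - |{psi_n <> 0}| / |G|] is [O (1 / n)].

   Weyl's law: a combination of the first [n + 1] eigenfunctions that vanishes
   on a grid of step [h] (edge ends included) satisfies Wirtinger's inequality
   on every cell, hence [lambda_n >= (pi / h)^2] as soon as [n + 1] exceeds the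
   number of grid points; sine arches of length [h] with disjoint supports give
   [lambda_n <= (pi / h)^2 + 2 ||q||_1 / h] as soon as there are more than [n] of
   them.  Therefore [s_n = (n + 1) / |G| + O (1)].

   Components of [{psi_n <> 0}] inside an edge: a component with two zeros as end
   points is at least [1 / s_n] long, by Wirtinger's inequality and [q >= 0].
   Conversely [psi_n] has a zero on every interval of length
   [1 / (s_n - O (1))], by Picone's identity for a sine arch.  All but at most
   two components per edge are of the first kind, and these are exactly nodal
   domains, whence [nu_n = s_n |{psi_n <> 0}| + O (1)].  As the components are
   weighed by the measure of [{psi_n <> 0}], no unique continuation is needed. *)

(** * Absolutely continuous functions *)

(** Since [q] is merely integrable, the eigenvalue equation is available only in weak form, so that
    no pointwise Sturm comparison is at hand. Every comparison therefore goes through functions that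
    vanish at all edge ends. Such functions satisfy the vertex conditions for any [w] and [V0], and
    their vertex form is zero; beyond its symmetry, [B] matters only for the semi-boundedness of the
    form, whose constant does not enter the result. The substitutions of Jacobi and Picone multiply
    and divide weakly differentiable functions, which is why a function is carried together with an
    explicit derivative and the product and quotient rules are proved from integral identities
    alone. On the graph, the obstacle is that components reaching an edge end may merge through a
    vertex. No attempt is made to describe the merging: the nodal count is squeezed between the
    number of components that stay away from the vertices and the number of all edgewise
    components. *)

Section integrals.
Context {R : realType}.
Implicit Types (a b c x y : R) (f g h : R -> R).

Definition integ a b f :=
  lebesgue_measure.-integrable `[a, b]%classic (EFin \o f).

Definition Int a b f : R := \int[lebesgue_measure]_(x in `[a, b]) f x.

Lemma integS a b c d f : integ a b f -> a <= c -> d <= b -> integ c d f.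
Proof.
move=> fi ac db; move: fi; apply: integrableS => //; apply: subset_itv; rewrite bnd_simp//.
Qed.

Lemma eq_integ a b f g : (forall x, a <= x <= b -> f x = g x) ->
  integ a b f -> integ a b g.
Proof.
move=> fg; apply: eq_integrable => // x; rewrite inE/= in_itv/= => xab.
by rewrite /= fg.
Qed.

Lemma integD a b f g : integ a b f -> integ a b g ->
  integ a b (fun x => f x + g x).
Proof. by move=> fi gi; exact: (integrableD _ fi gi). Qed.

Lemma integZ a b k f : integ a b f -> integ a b (fun x => k * f x).
Proof. by move=> fi; exact: (integrableZl _ k fi). Qed.

Lemma integN a b f : integ a b f -> integ a b (fun x => - f x).
Proof. by move=> fi; apply: (@eq_integ _ _ (fun x => (-1) * f x)) => [x _|];
  [rewrite mulN1r|exact: integZ]. Qed.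

Lemma integB a b f g : integ a b f -> integ a b g ->
  integ a b (fun x => f x - g x).
Proof. by move=> fi gi; apply: integD => //; exact: integN. Qed.

Lemma integ_cst a b k : integ a b (fun=> k).
Proof.
apply: continuous_compact_integrable; first exact: segment_compact.
by apply: continuous_subspaceT => x; exact: cvg_cst.
Qed.

Lemma integ0 a b : integ a b (fun=> 0).
Proof. exact: integ_cst. Qed.

Lemma integ_cont a b f : {within `[a, b], continuous f} -> integ a b f.
Proof. by move=> cf; apply: continuous_compact_integrable => //; exact: segment_compact. Qed.

Lemma integ_norm a b f : integ a b f -> integ a b (fun x => `|f x|).
Proof. exact: integrable_norm. Qed.

Lemma integ_meas a b f : integ a b f -> measurable_fun `[a, b] f.
Proof. by case/integrableP => /measurable_EFinP. Qed.

Lemma integ_le a b f g : measurable_fun `[a, b] f ->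
  (forall x, a <= x <= b -> `|f x| <= g x) -> integ a b g -> integ a b f.
Proof.
move=> mf fg; apply: le_integrable => //; first exact/measurable_EFinP.
move=> x; rewrite /= in_itv/= => xab; rewrite lee_fin.
by rewrite (le_trans (fg _ xab))// ler_norm.
Qed.

Lemma integM_bounded a b f g M : measurable_fun `[a, b] f ->
  (forall x, a <= x <= b -> `|f x| <= M) -> integ a b g ->
  integ a b (fun x => f x * g x).
Proof.
move=> mf fM gi; apply: (@integ_le _ _ _ (fun x => M * `|g x|)).
- by apply: measurable_funM => //; exact: integ_meas.
- by move=> x xab; rewrite normrM ler_wpM2r// fM.
- exact/integZ/integ_norm.
Qed.

Lemma cont_bounded a b f : {within `[a, b], continuous f} ->
  exists M, forall x, a <= x <= b -> `|f x| <= M.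
Proof.
move=> cf; have := continuous_compact cf (@segment_compact _ a b).
move=> /compact_bounded [M [_ HM]]; exists (M + 1) => x xab.
by apply: (HM (M + 1)); [rewrite ltrDl|exists x; rewrite //= in_itv].
Qed.

Lemma cont_meas a b f : {within `[a, b], continuous f} ->
  measurable_fun `[a, b] f.
Proof. by move=> cf; apply: subspace_continuous_measurable_fun. Qed.

Lemma integM_cont a b f g : {within `[a, b], continuous f} -> integ a b g ->
  integ a b (fun x => f x * g x).
Proof.
move=> cf; have [M fM] := cont_bounded cf.
exact: integM_bounded (cont_meas cf) fM.
Qed.

Lemma IntD a b f g : integ a b f -> integ a b g ->
  Int a b (fun x => f x + g x) = Int a b f + Int a b g.
Proof. exact: RintegralD. Qed.

Lemma IntB a b f g : integ a b f -> integ a b g ->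
  Int a b (fun x => f x - g x) = Int a b f - Int a b g.
Proof. exact: RintegralB. Qed.

Lemma IntZ a b k f : integ a b f -> Int a b (fun x => k * f x) = k * Int a b f.
Proof. exact: RintegralZl. Qed.

Lemma IntN a b f : integ a b f -> Int a b (fun x => - f x) = - Int a b f.
Proof.
move=> fi; rewrite -mulN1r -IntZ//.
by apply: eq_Rintegral => x _; rewrite mulN1r.
Qed.

Lemma eq_Int a b f g : (forall x, a <= x <= b -> f x = g x) ->
  Int a b f = Int a b g.
Proof. by move=> fg; apply: eq_Rintegral => x; rewrite inE/= in_itv/= => /fg. Qed.

Lemma Int_cst a b k : a <= b -> Int a b (fun=> k) = k * (b - a).
Proof.
move=> ab; rewrite /Int Rintegral_cst//= lebesgue_measure_itv/= lte_fin.
case: ltP => [_|ba]; first by rewrite -EFinB.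
by rewrite mulr0 (@le_anti _ _ a b) ?ab// subrr mulr0.
Qed.

Lemma Int0 a b : Int a b (fun=> 0) = 0.
Proof. by rewrite /Int Rintegral_cst// mul0r. Qed.

Lemma Int_same a f : Int a a f = 0.
Proof. by rewrite /Int set_itv1 Rintegral_set1. Qed.

Lemma Int_ge0 a b f : (forall x, a <= x <= b -> 0 <= f x) -> 0 <= Int a b f.
Proof. by move=> f0; apply: Rintegral_ge0 => x /=; rewrite in_itv/= => /f0. Qed.

Lemma le_Int a b f g : integ a b f -> integ a b g ->
  (forall x, a <= x <= b -> f x <= g x) -> Int a b f <= Int a b g.
Proof.
by move=> fi gi fg; apply: le_Rintegral => // x /=; rewrite in_itv/= => /fg.
Qed.

Lemma ler_norm_Int a b f : integ a b f ->
  `|Int a b f| <= Int a b (fun x => `|f x|).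
Proof. exact: le_normr_Rintegral. Qed.

Lemma Int_cat a b c f : a <= c -> c <= b -> integ a b f ->
  Int a b f = Int a c f + Int c b f.
Proof.
move=> ac cb fi; have := @Rintegral_itvB _ f (BLeft a) (BRight b) c fi.
rewrite !bnd_simp => /(_ ac cb) /eqP; rewrite subr_eq => /eqP.
rewrite /Int => ->; rewrite addrC; congr +%R.
rewrite Rintegral_itv_obnd_cbnd//.
by apply: integrableS fi => //; apply: subset_itvr; rewrite bnd_simp.
Qed.

Lemma integ_cat a b c f : a <= c -> c <= b -> integ a c f -> integ c b f ->
  integ a b f.
Proof.
move=> ac cb fi gi.
have E : `[a, b]%classic = `[a, c]%classic `|` `[c, b]%classic.
  apply/seteqP; split => x /=; rewrite !in_itv/=.
    by move=> /andP[ax xb]; case: (leP x c) => [xc|/ltW cx]; [left|right];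
      rewrite ?ax ?xc ?cx.
  by case=> /andP[H1 H2]; rewrite ?(le_trans _ H1)//= ?(le_trans H2)//= ?H1 ?H2.
rewrite /integ E; apply/integrableP; split.
  apply/measurable_funU => //; split; by apply: measurable_int; eassumption.
rewrite (_ : _ `|` _ = `[a, c[%classic `|` `[c, b]%classic); last first.
  rewrite -E; exact: itv_bndbnd_setU.
rewrite ge0_integral_setU//=; last 2 first.
- apply/measurable_EFinP/measurableT_comp => //.
  apply/measurable_funU => //; split; last exact: integ_meas.
  apply: measurable_funS (integ_meas fi) => //.
  by apply: subset_itvl; rewrite bnd_simp.
- apply/disj_setPS => y [/=]; rewrite !in_itv/= => /andP[_ yc] /andP[].
  by rewrite leNgt yc.
rewrite lte_add_pinfty//; last by case/integrableP: gi.
case/integrableP: (fi) => _; apply: le_lt_trans; apply: ge0_subset_integral => //.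
  by apply/measurable_EFinP/measurableT_comp => //; exact: (integ_meas fi).
by apply: subset_itvl; rewrite bnd_simp.
Qed.

(* [f] is absolutely continuous on [[a, b]] with derivative [g]. *)
Definition prim a b f g :=
  integ a b g /\ forall x, a <= x <= b -> f x = f a + Int a x g.

Lemma prim_integ a b f g : prim a b f g -> integ a b g.
Proof. by case. Qed.

Lemma prim_diff a b f g x y : prim a b f g -> a <= x -> x <= y -> y <= b ->
  f y - f x = Int x y g.
Proof.
move=> [gi fE] ax xy yb; rewrite (fE y) ?(le_trans ax)//.
rewrite (fE x) ?ax ?(le_trans xy)// (@Int_cat a y x)//; last exact: (integS gi).
by lra.
Qed.

Lemma primI a b f g : integ a b g ->
  (forall x y, a <= x -> x <= y -> y <= b -> f y - f x = Int x y g) ->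
  prim a b f g.
Proof.
move=> gi fE; split=> // x /andP[ax xb]; rewrite -fE//.
by rewrite addrC subrK.
Qed.

Lemma prim_sub a b c d f g : a <= c -> d <= b -> prim a b f g -> prim c d f g.
Proof.
move=> ac db fg; apply: primI; first exact: (integS (prim_integ fg) ac db).
move=> x y cx xy yd; apply: (prim_diff fg) => //.
- exact: le_trans cx.
- exact: le_trans db.
Qed.

Lemma eq_prim a b f1 f2 g1 g2 : (forall x, a <= x <= b -> f1 x = f2 x) ->
  (forall x, a <= x <= b -> g1 x = g2 x) -> prim a b f1 g1 -> prim a b f2 g2.
Proof.
move=> f12 g12 fg; apply: primI; first exact: eq_integ g12 (prim_integ fg).
move=> x y ax xy yb.
have xab : a <= x <= b by rewrite ax (le_trans xy).
have yab : a <= y <= b by rewrite yb (le_trans ax).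
rewrite -f12// -f12// (prim_diff fg)//; apply: eq_Int => z /andP[xz zy].
by apply: g12; rewrite (le_trans ax)//= (le_trans zy).
Qed.

Lemma primD a b f1 f2 g1 g2 : prim a b f1 g1 -> prim a b f2 g2 ->
  prim a b (fun x => f1 x + f2 x) (fun x => g1 x + g2 x).
Proof.
move=> fg1 fg2; have [i1 i2] := (prim_integ fg1, prim_integ fg2).
apply: primI; first exact: integD.
move=> x y ax xy yb; rewrite IntD; [|exact: (integS i1)|exact: (integS i2)].
by rewrite -(prim_diff fg1)// -(prim_diff fg2)//; lra.
Qed.

Lemma primZ a b k f g : prim a b f g ->
  prim a b (fun x => k * f x) (fun x => k * g x).
Proof.
move=> fg; apply: primI; first exact: integZ (prim_integ fg).
move=> x y ax xy yb; rewrite IntZ; last exact: (integS (prim_integ fg)).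
by rewrite -(prim_diff fg)//; lra.
Qed.

Lemma prim_cst a b k : prim a b (fun=> k) (fun=> 0).
Proof.
by apply: primI => [|x y *]; [exact: integ0|rewrite Int0 subrr].
Qed.

Lemma prim_cont a b f g : prim a b f g -> {within `[a, b], continuous f}.
Proof.
move=> [gi fE]; have [ba|ab] := ltP b a.
  by rewrite set_itv_ge ?bnd_simp -?ltNge//; exact: continuous_subspace0.
have cI := parameterized_integral_continuous ab gi.
have : {within `[a, b], continuous (fun x => f a + Int a x g)}.
  by move=> x; apply: (@continuousD _ _ (subspace `[a, b])) => //; [exact: cvg_cst|exact: cI].
apply: subspace_eq_continuous => x; rewrite inE/= in_itv/= => xab.
by rewrite /from_subspace/= [RHS]fE.
Qed.

Lemma prim_unif a b f g : prim a b f g -> forall e, 0 < e ->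
  exists2 d, 0 < d & forall x y, a <= x -> x <= y -> y <= b -> y - x <= d ->
    `|f y - f x| <= e.
Proof.
move=> fg e e0; have cf := prim_cont fg.
(* Near-covering compactness, with the step [d] tending to [0] from the right, makes the local
   modulus of continuity uniform. *)
have /compact_near_coveringP/(_ R 0^'+ (fun d x => forall y, a <= x -> x <= y ->
    y <= b -> y - x <= d -> `|f y - f x| <= e)) := @segment_compact R a b.
move=> [x /=|d /= d0 Hd].
- rewrite in_itv/= => xab.
  have : f @ within `[a, b] (nbhs x) --> f x.
    by move/subspace_continuousP: cf; apply; rewrite /= in_itv.
  move=> /cvgrPdist_le/(_ (e / 2)); rewrite divr_gt0// => /(_ isT).
  rewrite near_withinE => -[/= r r0 Hr].
  exists (ball x (r / 2), [set d | d < r / 2]); first split => /=.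
  + by apply: nbhsx_ballx; rewrite divr_gt0.
  + by apply: nbhs_right_lt; rewrite divr_gt0.
  move=> [x' d] [/= + dr] y ax' xy yb yd; rewrite /ball/= => xx'.
  have := Hr x'; rewrite /= in_itv/= ax' (le_trans xy)//.
  have -> : `|x - x'| < r by lra.
  have := Hr y; rewrite /= in_itv/= (le_trans ax')// yb.
  have -> : `|x - y| < r.
    rewrite (_ : x - y = (x - x') + (x' - y)); last lra.
    apply: le_lt_trans (ler_normD _ _) _.
    rewrite [X in _ + X]distrC (@ger0_norm _ (y - x')) ?subr_ge0//; lra.
  move=> /(_ isT isT) H1 /(_ isT isT) H2.
  rewrite (_ : f y - f x' = - (f x - f y) + (f x - f x')); last lra.
  apply: le_trans (ler_normD _ _) _; rewrite normrN; lra.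
exists (d / 2); first by rewrite divr_gt0.
move=> x y ax xy yb yx.
have := Hd (d / 2); rewrite /= sub0r normrN gtr0_norm ?divr_gt0//.
have -> : d / 2 < d by lra.
by move=> /(_ isT isT x); apply => //; rewrite /= in_itv/= ax (le_trans xy).
Qed.

(* Subdividing into short pieces makes the relative error arbitrarily small. *)
Lemma prim_crit a b f g m : integ a b g -> integ a b m ->
  (forall x, a <= x <= b -> 0 <= m x) ->
  (forall e, 0 < e -> exists2 d, 0 < d &
    forall x y, a <= x -> x <= y -> y <= b -> y - x <= d ->
    `|f y - f x - Int x y g| <= e * Int x y m) ->
  prim a b f g.
Proof.
move=> gi mi m0 H; apply: primI => // x y ax xy yb.
have I0 x' y' : a <= x' -> y' <= b -> 0 <= Int x' y' m.
  move=> ax' yb'; apply: Int_ge0 => z /andP[z1 z2]; apply: m0.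
  by rewrite (le_trans ax')//= (le_trans z2).
have K e : 0 < e -> `|f y - f x - Int x y g| <= e * Int x y m.
  move=> e0; have [d d0 Hd] := H _ e0.
  suff P n : forall x' , x <= x' -> x' <= y -> y - x' <= n%:R * d ->
     `|f y - f x' - Int x' y g| <= e * Int x' y m.
    have [n Hn] : exists n : nat, (y - x) / d <= n%:R.
      by exists (Num.trunc ((y - x) / d)).+1; exact/ltW/truncnS_gt.
    by apply: (P n) => //; rewrite -ler_pdivrMr.
  elim: n => [|n IH] x' xx' xy' yn.
    by rewrite mul0r in yn; apply: Hd => //; [exact: le_trans xx'|lra].
  have [yd|yd] := leP (y - x') d; first by apply: Hd => //; exact: le_trans xx'.
  have ax' : a <= x' by exact: le_trans xx'.
  have {IH} := IH (x' + d).
  have -> : x <= x' + d by lra.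
  have -> : x' + d <= y by lra.
  have -> : y - (x' + d) <= n%:R * d by rewrite -natr1 mulrDl in yn; lra.
  move=> /(_ isT isT isT) IH.
  have := Hd x' (x' + d) ax'; rewrite !lerDl (ltW d0).
  have -> : x' + d <= b by lra.
  have -> : x' + d - x' <= d by lra.
  move=> /(_ isT isT isT) Hx.
  rewrite (@Int_cat x' y (x' + d) g) ?(@Int_cat x' y (x' + d) m); try lra; last first.
  - exact: (integS gi).
  - exact: (integS mi).
  rewrite mulrDr; apply: le_trans (lerD Hx IH).
  apply: le_trans (ler_normD _ _); rewrite le_eqVlt; apply/orP; left; apply/eqP.
  by congr (`| _ |); lra.
apply/eqP; rewrite -subr_eq0 -normr_le0 leNgt; apply/negP => D0.
set D := `| _ | in K D0; set C := Int x y m in K.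
have C0 : 0 <= C by exact: I0.
have := K (D / (2 * (C + 1))); rewrite divr_gt0//; last by lra.
move=> /(_ isT); rewrite leNgt => /negP; apply.
rewrite mulrAC ltr_pdivrMr; last by lra.
rewrite ltr_pM2l//; lra.
Qed.

(** On a piece [[x, y]] the error is the integral of [g1 t * (f2 y - f2 t) + (f1 x - f1 t) * g2 t].
    Uniform continuity of the factors makes it small relative to the integral of [|g1| + |g2|],
    which is what [prim_crit] asks for. *)
Lemma primM a b f1 f2 g1 g2 : prim a b f1 g1 -> prim a b f2 g2 ->
  prim a b (fun x => f1 x * f2 x) (fun x => g1 x * f2 x + f1 x * g2 x).
Proof.
move=> fg1 fg2; have [i1 i2] := (prim_integ fg1, prim_integ fg2).
have j1 : integ a b (fun x => g1 x * f2 x).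
  by apply: eq_integ (integM_cont (prim_cont fg2) i1) => x _; rewrite mulrC.
have j2 := integM_cont (prim_cont fg1) i2.
apply: (@prim_crit _ _ _ _ (fun x => `|g1 x| + `|g2 x|)).
- exact: integD.
- by apply: integD; exact: integ_norm.
- by move=> x _; rewrite addr_ge0.
move=> e e0; have [d1 d10 H1] := prim_unif fg1 e0.
have [d2 d20 H2] := prim_unif fg2 e0.
exists (Num.min d1 d2); first by rewrite lt_min d10.
move=> x y ax xy yb; rewrite le_min => /andP[xyd1 xyd2].
have S f : integ a b f -> integ x y f by move=> h; exact: (integS h).
have := S _ i1; have := S _ i2; have := S _ j1; have := S _ j2 => k2 k1 h2 h1.
have n1 := integ_norm h1; have n2 := integ_norm h2.
have -> : f1 y * f2 y - f1 x * f2 x - Int x y (fun t => g1 t * f2 t + f1 t * g2 t)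
  = Int x y (fun t => g1 t * (f2 y - f2 t) + (f1 x - f1 t) * g2 t).
  transitivity (Int x y (fun t => f2 y * g1 t + f1 x * g2 t - (g1 t * f2 t + f1 t * g2 t))).
    rewrite IntB; [|by apply: integD; exact: integZ|exact: integD].
    rewrite (@IntD x y (fun t => f2 y * g1 t) (fun t => f1 x * g2 t)); [|exact: integZ|exact: integZ].
    rewrite !IntZ// -(prim_diff fg1)// -(prim_diff fg2)//; lra.
  by apply: eq_Int => t _; lra.
have ji : integ x y (fun t => g1 t * (f2 y - f2 t) + (f1 x - f1 t) * g2 t).
  apply: (@eq_integ _ _ (fun t => f2 y * g1 t + f1 x * g2 t - (g1 t * f2 t + f1 t * g2 t))).
    by move=> t _; lra.
  by apply: integB; apply: integD => //; exact: integZ.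
apply: le_trans (ler_norm_Int ji) _.
rewrite -IntZ; last exact: integD.
apply: le_Int; [exact: integ_norm|exact/integZ/integD|].
move=> t /andP[xt ty]; rewrite [leRHS]mulrDr; apply: le_trans (ler_normD _ _) _.
rewrite !normrM; apply: lerD.
  rewrite mulrC ler_wpM2r//; apply: H2 => //; [exact: le_trans xt|lra].
rewrite ler_wpM2r// distrC; apply: H1 => //; [exact: le_trans yb|lra].
Qed.

(** On a short piece [1 / f(t)^2] and [1 / (f(x) f(y))] differ by at most [2 c^-3] times the
    oscillation of [f]; this is the origin of the weight [2 * c ^- 3 * |g|]. *)
Lemma primV a b f g c : 0 < c -> (forall x, a <= x <= b -> c <= `|f x|) ->
  prim a b f g -> prim a b (fun x => (f x)^-1) (fun x => - (f x ^- 2 * g x)).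
Proof.
move=> c0 fc fg; have i := prim_integ fg; have cf := prim_cont fg.
have c20 : 0 < c ^- 2 by rewrite invr_gt0 exprn_gt0.
have mf2 : measurable_fun `[a, b] (fun x => f x ^- 2).
  apply: cont_meas; apply/subspace_continuousP => x xab.
  have /subspace_continuousP/(_ x xab) cfx := cf.
  apply: (cvgV _ (cvgM cfx cfx)); rewrite mulf_neq0//.
    by rewrite -normr_gt0 (lt_le_trans c0)// fc//; rewrite /= in_itv/= in xab.
  by rewrite -normr_gt0 (lt_le_trans c0)// fc//; rewrite /= in_itv/= in xab.
have bf2 x : a <= x <= b -> `|f x ^- 2| <= c ^- 2.
  move=> /fc h; rewrite normrV ?unitfE; last first.
    by rewrite expf_neq0// -normr_gt0 (lt_le_trans c0).
  rewrite normrX lef_pV2 ?posrE ?exprn_gt0//; last exact: lt_le_trans h.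
  by rewrite lerXn2r ?nnegrE// ltW.
have j : integ a b (fun x => f x ^- 2 * g x) by apply: integM_bounded bf2 i.
apply: (@prim_crit _ _ _ _ (fun x => 2 * c ^- 3 * `|g x|)).
- exact: integN.
- exact/integZ/integ_norm.
- by move=> x _; rewrite !mulr_ge0// invr_ge0 exprn_ge0// ltW.
move=> e e0; have [d d0 H] := prim_unif fg e0.
exists d => // x y ax xy yb xyd.
have S h : integ a b h -> integ x y h by move=> h'; exact: (integS h').
have := S _ i; have := S _ j => k h.
have xab : a <= x <= b by rewrite ax (le_trans xy).
have yab : a <= y <= b by rewrite yb (le_trans ax).
have nz t : a <= t <= b -> f t != 0 by move=> /fc /(lt_le_trans c0); rewrite normr_gt0.
have Sab t : x <= t <= y -> a <= t <= b.
  by move=> /andP[xt ty]; rewrite (le_trans ax)//= (le_trans ty).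
have -> : (f y)^-1 - (f x)^-1 - Int x y (fun t => - (f t ^- 2 * g t)) =
    Int x y (fun t => f t ^- 2 * g t - (f x * f y)^-1 * g t).
  rewrite IntN// IntB//; last exact: integZ.
  rewrite IntZ// -(prim_diff fg)//.
  by field; rewrite !nz.
have l : integ x y (fun t => f t ^- 2 * g t - (f x * f y)^-1 * g t).
  by apply: integB => //; exact: integZ.
apply: le_trans (ler_norm_Int l) _.
rewrite -IntZ; last exact/integZ/integ_norm.
apply: le_Int; [exact: integ_norm|exact/integZ/integZ/integ_norm|].
move=> t xty; have [/andP[xt ty] tab] := (xty, Sab _ xty).
rewrite -mulrBl normrM mulrA ler_wpM2r//.
have [fx fy ft] : [/\ c <= `|f x|, c <= `|f y| & c <= `|f t|] by split; apply: fc.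
have -> : f t ^- 2 - (f x * f y)^-1 =
   (f x)^-1 * (f y)^-1 * (f t)^-1 * (f x - f t) + (f y)^-1 * (f t)^-1 ^+ 2 * (f y - f t).
  by field; rewrite !nz.
have Hx : `|f x - f t| <= e.
  rewrite distrC; apply: H => //; [exact: le_trans yb|lra].
have Hy : `|f y - f t| <= e.
  apply: H => //; [exact: le_trans xt|lra].
have V z : c <= `|z| -> `|z^-1| <= c^-1.
  move=> cz; rewrite normfV lef_pV2 ?posrE//.
  exact: lt_le_trans cz.
have ci : 0 <= c^-1 by rewrite invr_ge0 ltW.
rewrite (_ : e * _ = c^-1 * c^-1 * c^-1 * e + c^-1 * c^-1 ^+ 2 * e); last first.
  by rewrite -exprVn; ring.
apply: le_trans (ler_normD _ _) _; rewrite !normrM ?normrX.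
by apply: lerD; rewrite !ler_pM ?mulr_ge0 ?exprn_ge0 ?lerXn2r ?nnegrE ?V.
Qed.

End integrals.

(** * Functions of class H^1 and Wirtinger's inequality *)

Section sobolev.
Context {R : realType}.
Implicit Types (a b c x y k : R) (f g h : R -> R).

Lemma cont_lb a b f : {within `[a, b], continuous f} ->
  (forall x, a <= x <= b -> f x != 0) ->
  exists2 c, 0 < c & forall x, a <= x <= b -> c <= `|f x|.
Proof.
move=> cf f0; have [ba|ab] := ltP b a.
  by exists 1 => // x /andP[/le_trans h /h]; rewrite leNgt ba.
have cnf : {within `[a, b], continuous (fun x => `|f x|)}.
  by move=> x; apply: cvg_norm; exact: cf.
have [c cab cmin] := EVT_min ab cnf.
exists `|f c|; first by rewrite normr_gt0 f0//; rewrite in_itv/= in cab.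
by move=> x xab; apply: cmin; rewrite in_itv.
Qed.

Lemma prim_C1 a b f g : (forall x : R, is_derive x 1 f (g x)) -> continuous g ->
  prim a b f g.
Proof.
move=> df cg; apply: primI; first by apply: integ_cont; exact: continuous_subspaceT.
have cf : continuous f.
  by move=> x; apply/differentiable_continuous/derivable1_diffP; case: (df x).
move=> x y ax; rewrite le_eqVlt => /predU1P[<- _|xy yb].
  by rewrite Int_same subrr.
rewrite /Int /Rintegral (@continuous_FTC2 _ g f x y)//.
- exact: continuous_subspaceT.
- split=> [z _||].
  + by case: (df z).
  + exact: cvg_at_right_filter (cf x).
  + exact: cvg_at_left_filter (cf y).
- by move=> z _; rewrite derive1E; case: (df z).
Qed.

Lemma is_derive_sin_affine k x0 (x : R) :
  is_derive x 1 (fun x => sin (k * (x - x0))) (k * cos (k * (x - x0))).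
Proof.
have H : is_derive x 1 (fun x => k * (x - x0)) k.
  by apply: is_derive_eq; rewrite /GRing.scale/= subr0 mulr1.
have D := @is_derive1_comp _ sin (fun x => k * (x - x0)) x _ _ (is_derive_sin _) H.
by apply: (is_derive_eq D); ring.
Qed.

Lemma is_derive_cos_affine k x0 (x : R) :
  is_derive x 1 (fun x => cos (k * (x - x0))) (- k * sin (k * (x - x0))).
Proof.
have H : is_derive x 1 (fun x => k * (x - x0)) k.
  by apply: is_derive_eq; rewrite /GRing.scale/= subr0 mulr1.
have D := @is_derive1_comp _ cos (fun x => k * (x - x0)) x _ _ (is_derive_cos _) H.
by apply: (is_derive_eq D); ring.
Qed.

Lemma prim_sin a b k x0 :
  prim a b (fun x => sin (k * (x - x0))) (fun x => k * cos (k * (x - x0))).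
Proof.
apply: prim_C1 => x; first exact: is_derive_sin_affine.
apply: cvgMr; apply/differentiable_continuous/derivable1_diffP.
by case: (is_derive_cos_affine k x0 x).
Qed.

Lemma prim_cos a b k x0 :
  prim a b (fun x => cos (k * (x - x0))) (fun x => - k * sin (k * (x - x0))).
Proof.
apply: prim_C1 => x; first exact: is_derive_cos_affine.
apply: cvgMr; apply/differentiable_continuous/derivable1_diffP.
by case: (is_derive_sin_affine k x0 x).
Qed.

Definition sqi a b g :=
  measurable_fun `[a, b] g /\ integ a b (fun x => g x ^+ 2).

Lemma sqiS a b c d g : sqi a b g -> a <= c -> d <= b -> sqi c d g.
Proof.
move=> [mg ig] ac db; split; last exact: (integS ig).
by apply: measurable_funS mg => //; apply: subset_itv; rewrite bnd_simp.
Qed.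

Lemma sqiM a b g h : sqi a b g -> sqi a b h -> integ a b (fun x => g x * h x).
Proof.
move=> [mg ig] [mh ih]; apply: (integ_le _ _ (integD ig ih)).
  exact: measurable_funM.
move=> x _; rewrite ler_norml; apply/andP; split.
  by have := sqr_ge0 (g x + h x); have := sqr_ge0 (g x - h x); nra.
by have := sqr_ge0 (g x + h x); have := sqr_ge0 (g x - h x); nra.
Qed.

Lemma sqi_cst a b k : sqi a b (fun=> k).
Proof. by split; [exact: measurable_cst|exact: integ_cst]. Qed.

Lemma sqi_integ a b g : sqi a b g -> integ a b g.
Proof.
move=> gi; apply: eq_integ (sqiM gi (sqi_cst a b 1)) => x _; exact: mulr1.
Qed.

Lemma sqiD a b g h : sqi a b g -> sqi a b h -> sqi a b (fun x => g x + h x).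
Proof.
move=> gi hi; split; first by apply: measurable_funD; [case: gi|case: hi].
apply: (@eq_integ _ _ _ (fun x => g x * g x + 2 * (g x * h x) + h x * h x)).
  by move=> x _; ring.
by apply: integD; [apply: integD; [|apply: integZ]|]; exact: sqiM.
Qed.

Lemma eq_sqi a b f g : (forall x, a <= x <= b -> f x = g x) ->
  sqi a b f -> sqi a b g.
Proof.
move=> fg fi; have := eq_integ fg (sqi_integ fi) => gi.
split; first exact: integ_meas.
by case: fi => _; apply: eq_integ => x /fg ->.
Qed.

Lemma sqiZ a b k g : sqi a b g -> sqi a b (fun x => k * g x).
Proof.
move=> [mg ig]; split; first exact: measurable_funM.
by apply: eq_integ (integZ (k ^+ 2) ig) => x _; rewrite exprMn.
Qed.

Lemma sqiM_cont a b f g : {within `[a, b], continuous f} -> sqi a b g ->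
  sqi a b (fun x => f x * g x).
Proof.
move=> cf [mg ig]; have mf := cont_meas cf; have [M fM] := cont_bounded cf.
split; first exact: measurable_funM.
apply: (@eq_integ _ _ _ (fun x => f x ^+ 2 * g x ^+ 2)) => [x _|].
  by rewrite exprMn.
apply: (@integM_bounded _ _ _ _ _ (M ^+ 2)) ig; first exact: measurable_funX.
move=> x xab; rewrite normrX lerXn2r ?nnegrE//; first exact: le_trans (fM x xab).
exact: fM.
Qed.

Lemma cont_sqi a b f : {within `[a, b], continuous f} -> sqi a b f.
Proof.
move=> cf; apply: eq_sqi (sqiM_cont cf (sqi_cst a b 1)) => x _; exact: mulr1.
Qed.

(** The Sobolev space H^1 on [[a, b]]. The derivative is an argument because it is determined only
    up to a null set, and explicit representatives keep the algebraic identities pointwise. *)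
Definition h1 a b f g := prim a b f g /\ sqi a b g.

Lemma h1_cont a b f g : h1 a b f g -> {within `[a, b], continuous f}.
Proof. by case=> /prim_cont. Qed.

Lemma h1_sqi a b f g : h1 a b f g -> sqi a b f.
Proof. by move/h1_cont/cont_sqi. Qed.

Lemma h1S a b c d f g : h1 a b f g -> a <= c -> d <= b -> h1 c d f g.
Proof. by move=> [p s] ac db; split; [exact: prim_sub p|exact: (sqiS s)]. Qed.

Lemma h1M a b f1 f2 g1 g2 : h1 a b f1 g1 -> h1 a b f2 g2 ->
  h1 a b (fun x => f1 x * f2 x) (fun x => g1 x * f2 x + f1 x * g2 x).
Proof.
move=> h1 h2; have [[p1 s1] [p2 s2]] := (h1, h2); split; first exact: primM.
apply: sqiD; last exact: sqiM_cont (h1_cont h1) s2.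
by apply: eq_sqi (sqiM_cont (h1_cont h2) s1) => x _; rewrite mulrC.
Qed.

Lemma h1V a b f g : (forall x, a <= x <= b -> f x != 0) -> h1 a b f g ->
  h1 a b (fun x => (f x)^-1) (fun x => - (f x ^- 2 * g x)).
Proof.
move=> f0 fg; have [c c0 fc] := cont_lb (h1_cont fg) f0; case: fg => p s.
have pV := primV c0 fc p; split => //.
have cV := prim_cont pV.
have := sqiM_cont cV (sqiM_cont cV (sqiZ (-1) s)).
by apply: eq_sqi => x _; rewrite -exprVn; ring.
Qed.

Lemma h1_sin a b k x0 :
  h1 a b (fun x => sin (k * (x - x0))) (fun x => k * cos (k * (x - x0))).
Proof.
split; first exact: prim_sin.
by apply: sqiZ; apply: cont_sqi; exact: prim_cont (prim_cos a b k x0).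
Qed.

Lemma h1_cos a b k x0 :
  h1 a b (fun x => cos (k * (x - x0))) (fun x => - k * sin (k * (x - x0))).
Proof.
split; first exact: prim_cos.
by apply: sqiZ; apply: cont_sqi; exact: prim_cont (prim_sin a b k x0).
Qed.

(* Jacobi's substitution: with [p = k tan (k (x - m))], which satisfies
   [p' = k^2 + p^2], one has [f'^2 - k^2 f^2 = (f' + f p)^2 - (f^2 p)']. *)
Lemma wirtinger_strict a b f g k : a <= b -> h1 a b f g -> f a = 0 -> f b = 0 ->
  0 < k -> k * (b - a) < pi ->
  k ^+ 2 * Int a b (fun x => f x ^+ 2) <= Int a b (fun x => g x ^+ 2).
Proof.
move=> ab fg fa fb k0 kpi; set m := (a + b) / 2.
(* As [m] is the midpoint and [k (b - a) < pi], the argument [k (x - m)] stays strictly between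
   [- pi / 2] and [pi / 2], end points included: the tangent is regular on the closed interval. *)
have cpos x : a <= x <= b -> cos (k * (x - m)) != 0.
  move=> /andP[ax xb]; rewrite gt_eqF// cos_gt0_pihalf//.
  by rewrite /m; apply/andP; split; nra.
pose p x := k * (sin (k * (x - m)) * (cos (k * (x - m)))^-1).
have hp : prim a b p (fun x => k ^+ 2 + p x ^+ 2).
  have := primZ k (h1M (h1_sin a b k m) (h1V cpos (h1_cos a b k m))).1.
  apply: eq_prim => // x /cpos c0; rewrite /p; field.
  by rewrite c0.
have hp1 : h1 a b p (fun x => k ^+ 2 + p x ^+ 2).
  have cp := prim_cont hp; split=> //; apply: sqiD; first exact: sqi_cst.
  by apply: eq_sqi (sqiM_cont cp (cont_sqi cp)) => x _.
have [[F _] G] := (h1M (h1M fg fg) hp1, h1_sqi fg).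
have := prim_diff F (lexx a) ab (lexx b); rewrite fa fb !mul0r subrr.
have sp := h1_sqi hp1; have [_ sg] := fg.
have ip : integ a b (fun x => (g x + p x * f x) ^+ 2).
  by have [] := sqiD sg (sqiM_cont (prim_cont hp) G).
have [_ ig] := sg; have [_ iff] := G.
move=> I0.
have : 0 <= Int a b (fun x => (g x + p x * f x) ^+ 2).
  by apply: Int_ge0 => x _; exact: sqr_ge0.
have -> : Int a b (fun x => (g x + p x * f x) ^+ 2) =
  Int a b (fun x => (g x ^+ 2 - k ^+ 2 * f x ^+ 2) +
     ((g x * f x + f x * g x) * p x + f x * f x * (k ^+ 2 + p x ^+ 2))).
  by apply: eq_Int => x _; ring.
rewrite IntD; last 2 first.
- by apply: integB => //; exact: integZ.
- exact: prim_integ F.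
by rewrite -I0 addr0 IntB ?subr_ge0 ?IntZ//; exact: integZ.
Qed.

(** At [k (b - a) = pi] the tangent blows up at both ends, so the strict case is applied to [t * k]
    with [t < 1] and [t] is let tend to 1. *)
Lemma wirtinger a b f g k : a <= b -> h1 a b f g -> f a = 0 -> f b = 0 ->
  0 <= k -> k * (b - a) <= pi ->
  k ^+ 2 * Int a b (fun x => f x ^+ 2) <= Int a b (fun x => g x ^+ 2).
Proof.
move=> ab fg fa fb k0 kpi.
set A := Int _ _ _; set B := Int _ _ _.
have A0 : 0 <= A by apply: Int_ge0 => x _; exact: sqr_ge0.
have B0 : 0 <= B by apply: Int_ge0 => x _; exact: sqr_ge0.
have H t : 0 < t < 1 -> (t * k) ^+ 2 * A <= B.
  move=> /andP[t0 t1]; have [->|kn0] := eqVneq k 0.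
    by rewrite mulr0 expr0n mul0r.
  have {}k0 : 0 < k by rewrite lt_def kn0.
  apply: wirtinger_strict => //; first exact: mulr_gt0.
  have := pi_gt0 R; nra.
rewrite leNgt; apply/negP => BA.
(* Chosen so that [(1 - e)^2 k^2 A = B + e^2 k^2 A], which exceeds [B]. *)
pose e := (k ^+ 2 * A - B) / (2 * (k ^+ 2 * A)).
have P0 : 0 < k ^+ 2 * A by exact: le_lt_trans BA.
have e0 : 0 < e by rewrite divr_gt0 ?subr_gt0// mulr_gt0.
have eE : e * (2 * (k ^+ 2 * A)) = k ^+ 2 * A - B by rewrite divfK// gt_eqF// mulr_gt0.
have e1 : e < 1 by rewrite ltNge; apply/negP => e1; nra.
have := H (1 - e); rewrite subr_gt0 e1 ltrBlDr ltrDl e0 => /(_ isT).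
rewrite exprMn -mulrA => H'.
have : e ^+ 2 * (k ^+ 2 * A) > 0 by rewrite mulr_gt0// exprn_gt0.
nra.
Qed.
End sobolev.

(** * Gluing, extension by zero, uniqueness of the derivative *)

Section extension.
Context {R : realType}.
Implicit Types (a b c l x y k : R) (f g h : R -> R).

Lemma integ_oo a b f g : (forall x, a < x < b -> f x = g x) ->
  integ a b f -> integ a b g.
Proof.
move=> fg fi; have mf := integ_meas fi.
have mf' : measurable_fun `]a, b[ f.
  by apply: measurable_funS mf => //; exact: subset_itv_oo_cc.
have mg' : measurable_fun `]a, b[ g.
  by apply: eq_measurable_fun mf' => x; rewrite inE/= in_itv/= => /fg.
have mg : measurable_fun `[a, b] g.
  by apply/measurable_fun_itv_bndo_bndcP/measurable_fun_itv_obnd_cbndP.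
apply/integrableP; split; first exact/measurable_EFinP.
have mE h : measurable_fun `]a, b[ h ->
    measurable_fun `]a, b[ (fun x => `|(EFin \o h) x|%E).
  by move=> mh; apply/measurable_EFinP/measurableT_comp.
case/integrableP: fi => _.
have -> := @integral_itv_bndoo _ a b _ true false (mE _ mf').
have -> := @integral_itv_bndoo _ a b _ true false (mE _ mg').
congr (_ < _)%E; apply: eq_integral => x; rewrite inE/= in_itv/= => /fg.
by move=> ->.
Qed.

Lemma Int_oo a b f g : (forall x, a < x < b -> f x = g x) ->
  integ a b f -> Int a b f = Int a b g.
Proof.
move=> fg fi; have gi := integ_oo fg fi; rewrite /Int /Rintegral.
have S h : integ a b h -> measurable_fun `]a, b[ (EFin \o h).
  move=> /integ_meas mh; apply/measurable_EFinP.
  by apply: measurable_funS mh => //; exact: subset_itv_oo_cc.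
have -> := @integral_itv_bndoo _ a b _ true false (S _ gi).
have -> := @integral_itv_bndoo _ a b _ true false (S _ fi).
congr fine; apply: eq_integral => x; rewrite inE/= in_itv/= => /fg.
by move=> ->.
Qed.

Lemma prim_cat a b c f g : a <= c -> c <= b -> prim a c f g -> prim c b f g ->
  prim a b f g.
Proof.
move=> ac cb p1 p2; have gi := integ_cat ac cb (prim_integ p1) (prim_integ p2).
apply: primI => // x y ax xy yb.
have [yc|cy] := leP y c; first exact: prim_diff p1 _ _ _.
have [cx|xc] := leP c x; first exact: prim_diff p2 _ _ _.
rewrite (@Int_cat _ x y c) ?ltW//; last exact: (integS gi).
by rewrite -(prim_diff p1)// ?ltW// -(prim_diff p2)// ?ltW//; lra.
Qed.

Lemma sqi_cat a b c g : a <= c -> c <= b -> sqi a c g -> sqi c b g -> sqi a b g.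
Proof.
move=> ac cb s1 s2; split; last by case: s1 s2 => _ i1 [_ i2]; exact: integ_cat i1 i2.
exact: (integ_meas (integ_cat ac cb (sqi_integ s1) (sqi_integ s2))).
Qed.

Lemma sqi_oo a b f g : (forall x, a < x < b -> f x = g x) ->
  sqi a b f -> sqi a b g.
Proof.
move=> fg fi; split; first exact: (integ_meas (integ_oo fg (sqi_integ fi))).
by case: fi => _; apply: integ_oo => x /fg ->.
Qed.

(** The derivative may be altered at the end points, as happens there when a function is extended by
    zero. *)
Lemma h1_oo a b f f' g g' : (forall x, a <= x <= b -> f x = f' x) ->
  (forall x, a < x < b -> g x = g' x) -> h1 a b f g -> h1 a b f' g'.
Proof.
move=> ff gg [p s]; split; last exact: sqi_oo s.
apply: primI; first exact: integ_oo (prim_integ p).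
move=> x y ax xy yb; rewrite -!ff ?ax ?yb ?(le_trans ax xy) ?(le_trans xy)//.
rewrite (prim_diff p)//; apply: Int_oo => [z /andP[xz zy]|].
  by apply: gg; rewrite (le_lt_trans ax)//= (lt_le_trans zy).
exact: (integS (prim_integ p)).
Qed.

Lemma h1_cat a b c f g : a <= c -> c <= b -> h1 a c f g -> h1 c b f g ->
  h1 a b f g.
Proof.
move=> ac cb [p1 s1] [p2 s2].
by split; [exact: prim_cat p1 p2|exact: sqi_cat s1 s2].
Qed.

Lemma h1D a b f1 f2 g1 g2 : h1 a b f1 g1 -> h1 a b f2 g2 ->
  h1 a b (fun x => f1 x + f2 x) (fun x => g1 x + g2 x).
Proof. by move=> [p1 s1] [p2 s2]; split; [exact: primD|exact: sqiD]. Qed.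

Lemma h1Z a b k f g : h1 a b f g -> h1 a b (fun x => k * f x) (fun x => k * g x).
Proof. by move=> [p s]; split; [exact: primZ|exact: sqiZ]. Qed.

Lemma h1_cst a b k : h1 a b (fun=> k) (fun=> 0).
Proof. by split; [exact: prim_cst|exact: sqi_cst]. Qed.

Lemma h1_id a b : h1 a b id (fun=> 1).
Proof.
split; last exact: sqi_cst; apply: primI; first exact: integ_cst.
by move=> x y ax xy yb; rewrite Int_cst// mul1r.
Qed.

(** The support is half-open, so that extensions from adjacent cells have product zero at every
    point and not only almost everywhere. *)
Definition ext a b f x := if a <= x < b then f x else 0.

Lemma Mext a b f g x : g x * ext a b f x = ext a b (fun y => g y * f y) x.
Proof. by rewrite /ext; case: ifP => // _; rewrite mulr0. Qed.

Lemma ext_disj a b c d f g x : b <= c -> ext a b f x * ext c d g x = 0.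
Proof.
move=> bc; rewrite /ext; case: ifP => [/andP[_ xb]|]; last by rewrite mul0r.
by rewrite leNgt (lt_le_trans xb bc) mulr0.
Qed.

Section ext.
Variables (a b l : R).
Hypotheses (a0 : 0 <= a) (ab : a <= b) (bl : b <= l).

Let ext_l f x : 0 < x < a -> 0 = ext a b f x.
Proof. by move=> /andP[_ xa]; rewrite /ext leNgt xa. Qed.

Let ext_m f x : a < x < b -> f x = ext a b f x.
Proof. by move=> /andP[ax xb]; rewrite /ext (ltW ax) xb. Qed.

Let ext_r f x : b < x < l -> 0 = ext a b f x.
Proof. by move=> /andP[bx _]; rewrite /ext (ltNge x) (ltW bx) andbF. Qed.

Lemma integ_ext f : integ a b f -> integ 0 l (ext a b f).
Proof.
move=> fi; apply: (@integ_cat _ _ _ a) => //; first exact: le_trans bl.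
  by apply: (@integ_oo _ _ (fun=> 0)); [exact: ext_l|exact: integ0].
apply: (@integ_cat _ _ _ b) => //; first by apply: integ_oo fi; exact: ext_m.
by apply: (@integ_oo _ _ (fun=> 0)); [exact: ext_r|exact: integ0].
Qed.

Lemma Int_ext f : integ a b f -> Int 0 l (ext a b f) = Int a b f.
Proof.
move=> fi; have ei := integ_ext fi.
rewrite (@Int_cat _ 0 l a)//; last exact: le_trans bl.
rewrite (@Int_cat _ a l b)//; last exact: (integS ei).
rewrite -(Int_oo (@ext_l f)); last exact: integ0.
rewrite -(Int_oo (@ext_r f)); last exact: integ0.
rewrite -(Int_oo (@ext_m f))//.
by rewrite !Int0 add0r addr0.
Qed.

Lemma h1_ext f g : h1 a b f g -> f a = 0 -> f b = 0 ->
  h1 0 l (ext a b f) (ext a b g).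
Proof.
move=> fg fa fb; apply: (@h1_cat _ _ a) => //; first exact: le_trans bl.
  apply: (@h1_oo _ _ (fun=> 0) _ (fun=> 0)); [|exact: ext_l|exact: h1_cst].
  move=> x /andP[_]; rewrite le_eqVlt /ext => /predU1P[->|xa].
    by rewrite fa; case: ifP.
  by rewrite leNgt xa.
apply: (@h1_cat _ _ b) => //.
  apply: h1_oo fg => [x /andP[ax]|x]; last exact: ext_m.
  by rewrite le_eqVlt /ext ax => /predU1P[->|->//]; rewrite fb ltxx.
apply: (@h1_oo _ _ (fun=> 0) _ (fun=> 0)); [|exact: ext_r|exact: h1_cst].
by move=> x /andP[bx _]; rewrite /ext (ltNge x) bx andbF.
Qed.

End ext.

(** By Lebesgue differentiation, an integrable function is almost everywhere the derivative of its
    indefinite integral. The function is first extended by zero to the whole line. *)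
Lemma prim_unique a b g : integ a b g ->
  (forall x, a <= x <= b -> Int a x g = 0) ->
  {ae lebesgue_measure, forall x, a <= x <= b -> g x = 0}.
Proof.
move=> gi I0; pose G := g \_ `[a, b].
have Gi : lebesgue_measure.-integrable setT (EFin \o G).
  rewrite /G -restrict_EFin; exact/(integrable_mkcond _ _).1.
have GiS (A : set R) : measurable A -> lebesgue_measure.-integrable A (EFin \o G).
  by move=> mA; exact: integrableS Gi.
have locG : locally_integrable setT G.
  exact: integrable_locally.
have iG y : lebesgue_measure.-integrable [set` Interval (BLeft a) (BRight y)] (EFin \o G).
  exact: GiS.
have aeab : {ae lebesgue_measure, forall x : R, x != a /\ x != b}.
  exists ([set a] `|` [set b]); split.
  - exact: measurableU.
  - by apply/countable_lebesgue_measure0/finite_set_countable.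
  - move=> x /= /not_andP[] /negP; rewrite negbK => /eqP ->; [left|right] => //.
have := FTC1 iG locG; move: aeab.
apply: (@filterS2 _ _ (ae_filter_ringOfSetsType lebesgue_measure)).
move=> x [xa xb] FG /andP[ax xb'].
have {}ax : a < x by rewrite lt_neqAle eq_sym xa.
have {}xb : x < b by rewrite lt_neqAle xb.
have Gx : G x = g x by rewrite /G patchE mem_set//= in_itv/= !ltW.
have [|_] := FG; [by rewrite /= lte_fin|rewrite Gx => <-; rewrite derive1E].
apply: (@etrans _ _ ('D_1 (cst 0 : R -> R) x)); last exact: derive_cst.
apply: near_eq_derive => //.
have : \forall y \near x, y \in `]a, b[ by apply: near_in_itvoo; rewrite in_itv/= ax.
apply: filterS => y; rewrite in_itv/= => /andP[ay yb].
rewrite -(I0 y) ?(ltW ay) ?(ltW yb)//.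
apply: eq_Rintegral => z; rewrite inE/= in_itv/= => /andP[az zy].
by rewrite /G patchE mem_set//= in_itv/= az (le_trans zy (ltW yb)).
Qed.

End extension.

(** * One-dimensional inequalities *)

Section one_dimensional_inequalities.
Context {R : realType}.
Implicit Types (a b c d l x y k : R) (f g h q : R -> R).

Lemma eq_Int_ae a b f g : measurable_fun `[a, b] f -> measurable_fun `[a, b] g ->
  {ae lebesgue_measure, forall x, a <= x <= b -> f x = g x} ->
  Int a b f = Int a b g.
Proof.
move=> mf mg fg; congr fine; apply: ae_eq_integral => //.
- exact/measurable_EFinP.
- exact/measurable_EFinP.
- apply: (@filterS _ _ (ae_filter_ringOfSetsType lebesgue_measure)) fg.
  by move=> x fgx /=; rewrite in_itv/= => /fgx ->.
Qed.

Lemma Int_ge0_ae a b f : integ a b f ->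
  {ae lebesgue_measure, forall x, a <= x <= b -> 0 <= f x} -> 0 <= Int a b f.
Proof.
move=> fi f0; rewrite (@eq_Int_ae a b f (fun x => `|f x|)).
- by apply: Int_ge0 => x _.
- exact: (integ_meas fi).
- exact: (integ_meas (integ_norm fi)).
- apply: (@filterS _ _ (ae_filter_ringOfSetsType lebesgue_measure)) f0.
  by move=> x fx /fx; move/ger0_norm.
Qed.

Lemma Int_gt0 a b f z : a < z < b -> {within `[a, b], continuous f} ->
  (forall x, a <= x <= b -> 0 <= f x) -> 0 < f z -> 0 < Int a b f.
Proof.
move=> /andP[az zb] cf f0 fz.
have cz : f @ within `[a, b] (nbhs z) --> f z.
  by move/subspace_continuousP: cf; apply; rewrite /= in_itv/= !ltW.
move/cvgrPdist_le: cz => /(_ (f z / 2)); rewrite divr_gt0// => /(_ isT).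
rewrite near_withinE => -[/= r r0 Hr].
pose e := Num.min (r / 2) (b - z).
have e0 : 0 < e by rewrite lt_min divr_gt0// subr_gt0.
have [er eb] : e <= r / 2 /\ e <= b - z by rewrite !ge_min !lexx orbT.
have fi := integ_cont cf.
rewrite (@Int_cat _ a b z) ?ltW//.
have [ze zeb za] : [/\ z <= z + e, z + e <= b & a <= z] by split; lra.
rewrite (@Int_cat _ z b (z + e))//; last exact: (integS fi).
apply: (@lt_le_trans _ _ (f z / 2 * e)); first by rewrite mulr_gt0// divr_gt0.
have P1 : 0 <= Int a z f.
  by apply: Int_ge0 => t /andP[t1 t2]; apply: f0; lra.
have P2 : 0 <= Int (z + e) b f.
  by apply: Int_ge0 => t /andP[t1 t2]; apply: f0; lra.
suff : f z / 2 * e <= Int z (z + e) f by lra.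
have -> : f z / 2 * e = Int z (z + e) (fun=> f z / 2).
  by rewrite Int_cst; lra.
apply: le_Int; [exact: integ_cst|exact: (integS fi)|].
move=> t /andP[t1 t2]; have := Hr t; rewrite /= in_itv/=.
have -> : a <= t <= b by lra.
have -> : `|z - t| < r by rewrite distrC ger0_norm ?subr_ge0//; lra.
move=> /(_ isT isT) H; have := ler_norm (f z - f t); lra.
Qed.

(** Integrate the derivative of [f^2 (x - c) / (b - a)]. When [c] is one end, the weight vanishes
    there and isolates the value of [f] at the other end. *)
Lemma affine_weight a b c f g : a < b -> h1 a b f g ->
  f b ^+ 2 * ((b - c) / (b - a)) - f a ^+ 2 * ((a - c) / (b - a)) =
  Int a b (fun x => 2 * (g x * f x * ((x - c) / (b - a))) + f x ^+ 2 / (b - a)).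
Proof.
move=> ab fg; have hw : h1 a b (fun x => (b - a)^-1 * (x + - c)) (fun=> (b - a)^-1 * (1 + 0)).
  by apply/h1Z/h1D; [exact: h1_id|exact: h1_cst].
have [F _] := h1M (h1M fg fg) hw.
have := prim_diff F (lexx a) (ltW ab) (lexx b).
rewrite (_ : _ - _ = f b ^+ 2 * ((b - c) / (b - a)) - f a ^+ 2 * ((a - c) / (b - a))).
  by move=> ->; apply: eq_Int => x _; ring.
by ring.
Qed.

(** The affine weight [w] that vanishes at the opposite end [c'] satisfies [|w| <= 1]; Young's
    inequality [2 g f w <= e g^2 + e^-1 f^2] then puts an arbitrarily small constant in front of the
    energy. *)
Lemma trace a b c f g e : a < b -> h1 a b f g -> 0 < e -> c = a \/ c = b ->
  f c ^+ 2 <= e * Int a b (fun x => g x ^+ 2)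
              + (e^-1 + (b - a)^-1) * Int a b (fun x => f x ^+ 2).
Proof.
move=> ab fg e0 cab.
have [[p s] s'] := (fg, h1_sqi fg); have ba : 0 < b - a by rewrite subr_gt0.
pose c' := a + b - c.
have cE : c' = a \/ c' = b by rewrite /c'; case: cab => ->; [right|left]; lra.
have := affine_weight c' ab fg.
have -> : f b ^+ 2 * ((b - c') / (b - a)) - f a ^+ 2 * ((a - c') / (b - a)) = f c ^+ 2.
  rewrite /c'; case: cab => ->; field; rewrite gt_eqF//.
move=> ->; rewrite -!IntZ; [|by case: s'|by case: s].
rewrite -IntD; [|by apply: integZ; case: s|by apply: integZ; case: s'].
have w1 x : a <= x <= b -> -1 <= (x - c') / (b - a) <= 1.
  move=> xab; rewrite ler_pdivlMr// ler_pdivrMr//; case: cE => ->; lra.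
apply: le_Int => [||x /w1].
- apply: integD; last first.
    by apply: eq_integ (integZ (b - a)^-1 s'.2) => x _; rewrite mulrC.
  apply: integZ.
  apply: (@eq_integ _ _ _ (fun x => ((b - a)^-1 * (x + - c')) * (g x * f x))).
    by move=> x _; ring.
  apply: integM_cont; last exact: sqiM.
  apply: (@h1_cont _ _ _ _ (fun=> (b - a)^-1 * (1 + 0))).
  by apply/h1Z/h1D; [exact: h1_id|exact: h1_cst].
- by apply: integD; apply: integZ; [case: s|case: s'].
set w := _ / _ => /andP[w0 w1'].
rewrite -subr_ge0; set W := (b - a)^-1.
have : 0 <= e^-1 * ((e * g x - w * f x) ^+ 2 + (1 - w ^+ 2) * f x ^+ 2).
  apply: mulr_ge0; first by rewrite invr_ge0 ltW.
  apply: addr_ge0; first exact: sqr_ge0.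
  by apply: mulr_ge0; [nra|exact: sqr_ge0].
have -> : e^-1 * ((e * g x - w * f x) ^+ 2 + (1 - w ^+ 2) * f x ^+ 2) =
  e * g x ^+ 2 + (e^-1 + W) * f x ^+ 2 - (2 * (g x * f x * w) + f x ^+ 2 * W).
  by field; rewrite gt_eqF.
by [].
Qed.

(** The energy identity and [q >= 0] bound the integral of [f'^2] by [lam] times that of [f^2], and
    Wirtinger's inequality with [k = pi / (y - x)] bounds it from below. *)
Lemma gap x y f g q lam : x < y -> h1 x y f g -> f x = 0 -> f y = 0 ->
  integ x y q -> {ae lebesgue_measure, forall t, x <= t <= y -> 0 <= q t} ->
  Int x y (fun t => g t * g t + q t * f t * f t) = lam * Int x y (fun t => f t * f t) ->
  0 < Int x y (fun t => f t * f t) ->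
  (pi / (y - x)) ^+ 2 <= lam.
Proof.
move=> xy fg fx fy iq q0 E P; have yx : 0 < y - x by rewrite subr_gt0.
rewrite -(ler_pM2r P) -E.
have := @wirtinger _ x y f g (pi / (y - x)) (ltW xy) fg fx fy.
rewrite divr_ge0 ?pi_ge0 ?(ltW yx)// divfK ?gt_eqF// lexx => /(_ isT isT).
have sg := fg.2; have ig2 := sqiM sg sg.
have iqf : integ x y (fun t => q t * f t * f t).
  apply: (@eq_integ _ _ _ (fun t => f t * (f t * q t))) => [t _|]; first by ring.
  by do 2 (apply: (integM_cont (h1_cont fg))).
move=> H; apply: le_trans (_ : Int x y (fun t => g t * g t) <= _) => //.
rewrite IntD// lerDl; apply: Int_ge0_ae => //.
apply: (@filterS _ _ (ae_filter_ringOfSetsType lebesgue_measure)) q0 => t qt /qt {}qt.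
by rewrite -mulrA mulr_ge0// -expr2 sqr_ge0.
Qed.

(** Over a full arch [sin * cos] returns to zero, so the integrals of [sin^2] and [cos^2] coincide;
    their sum is [d]. *)
Lemma Int_sin2 x d (k := pi / d) : 0 < d ->
  Int x (x + d) (fun t => sin (k * (t - x)) ^+ 2) = d / 2.
Proof.
move=> d0; have [F _] := h1M (h1_sin x (x + d) k x) (h1_cos x (x + d) k x).
have xd : x <= x + d by rewrite lerDl ltW.
have k0 : k != 0 by rewrite mulf_neq0// ?gt_eqF ?invr_gt0// pi_gt0.
have := prim_diff F (lexx _) xd (lexx _).
rewrite subrr mulr0 sin0 mul0r.
rewrite (_ : k * (x + d - x) = pi); last by rewrite /k; field; rewrite gt_eqF.
rewrite sinpi mul0r subrr.
have [_ isn] := h1_sqi (h1_sin x (x + d) k x).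
have [_ ic] := h1_sqi (h1_cos x (x + d) k x).
rewrite (@eq_Int _ _ _ _ (fun t =>
    k * cos (k * (t - x)) ^+ 2 - k * sin (k * (t - x)) ^+ 2)); last first.
  by move=> t _; ring.
rewrite IntB ?IntZ//; try exact: integZ.
rewrite -mulrBr => /esym/eqP; rewrite mulf_eq0 (negbTE k0)/=.
rewrite subr_eq0 => /eqP E.
have : Int x (x + d) (fun=> 1) = d by rewrite Int_cst//; ring.
rewrite (@eq_Int _ _ _ _ (fun t => cos (k * (t - x)) ^+ 2 + sin (k * (t - x)) ^+ 2)).
  by rewrite IntD// E => {2}<-; field.
by move=> t _; rewrite cos2Dsin2.
Qed.

Lemma Int_cos2 x d (k := pi / d) : 0 < d ->
  Int x (x + d) (fun t => (k * cos (k * (t - x))) ^+ 2) = k ^+ 2 * (d / 2).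
Proof.
move=> d0; have xd : x <= x + d by rewrite lerDl ltW.
have [_ isn] := h1_sqi (h1_sin x (x + d) k x).
have [_ ic] := h1_sqi (h1_cos x (x + d) k x).
rewrite (@eq_Int _ _ _ _ (fun t => k ^+ 2 * (1 - sin (k * (t - x)) ^+ 2))); last first.
  by move=> t _; rewrite -cos2sin2 exprMn.
have i1 := @integ_cst R x (x + d) 1.
rewrite IntZ; last exact: integB.
by rewrite IntB// Int_sin2// Int_cst//; field.
Qed.

Lemma sin_bump_le1 k x (t : R) : sin (k * (t - x)) ^+ 2 <= 1.
Proof. by rewrite -(cos2Dsin2 (k * (t - x))) lerDr sqr_ge0. Qed.

Lemma Int_q_sin2 x d k q : integ x (x + d) q ->
  Int x (x + d) (fun t => q t * sin (k * (t - x)) ^+ 2) <=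
  Int x (x + d) (fun t => `|q t|).
Proof.
move=> iq; apply: le_Int; last 1 first.
- move=> t _; apply: le_trans (ler_norm _) _; rewrite normrM -[leRHS]mulr1 ler_wpM2l//.
  by rewrite ger0_norm ?sqr_ge0// sin_bump_le1.
- have cs := h1_cont (h1_sin x (x + d) k x).
  apply: eq_integ (integM_cont cs (integM_cont cs iq)) => t _ /=; ring.
- exact: integ_norm.
Qed.

(* Picone: testing with [s^2 / f] costs at most the energy of [s], because
   [f' (s^2 / f)' = s'^2 - (s' - s f' / f)^2]. *)
Lemma picone x d f g q lam : 0 < d -> h1 x (x + d) f g -> integ x (x + d) q ->
  (forall t, x <= t <= x + d -> f t != 0) ->
  (forall p r, h1 x (x + d) p r -> p x = 0 -> p (x + d) = 0 ->
    Int x (x + d) (fun t => g t * r t + q t * f t * p t) =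
    lam * Int x (x + d) (fun t => f t * p t)) ->
  lam <= (pi / d) ^+ 2 + 2 * Int x (x + d) (fun t => `|q t|) / d.
Proof.
move=> d0 fg iq f0 weak; set k := pi / d; set Q := Int _ _ _.
have hs := h1_sin x (x + d) k x; have hV := h1V f0 fg.
have hp := h1M (h1M hs hs) hV.
have s2 : sin (k * (x + d - x)) = 0.
  by rewrite (_ : k * _ = pi) ?sinpi// /k; field; rewrite gt_eqF.
have := weak _ _ hp; rewrite subrr mulr0 sin0 !mul0r s2 !mul0r => /(_ erefl erefl).
rewrite (@eq_Int _ _ _ (fun t => f t * _) (fun t => sin (k * (t - x)) ^+ 2)); last first.
  by move=> t /f0 ft; field; rewrite ft.
rewrite Int_sin2//.
have sg := fg.2; have sp := hp.2.
have cs := h1_cont hs.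
have iqs : integ x (x + d) (fun t => q t * sin (k * (t - x)) ^+ 2).
  by apply: eq_integ (integM_cont cs (integM_cont cs iq)) => t _ /=; ring.
have [_ ic] := hs.2.
move=> E; have : lam * (d / 2) <= k ^+ 2 * (d / 2) + Q.
  rewrite -E -(Int_cos2 x d0); apply: le_trans (lerD (lexx _) (Int_q_sin2 k iq)).
  rewrite -IntD//; apply: le_Int; last 1 first.
  - move=> t /f0 ft; rewrite -subr_ge0.
    set S := sin _; set C := cos _.
    suff -> : (k * C) ^+ 2 + q t * S ^+ 2 -
        (g t * ((k * C * S + S * (k * C)) / f t + S * S * - (f t ^- 2 * g t)) +
         q t * f t * (S * S / f t)) = (k * C - S * g t / f t) ^+ 2.
      exact: sqr_ge0.
    by field.
  - apply: integD; first exact: sqiM.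
    by apply: eq_integ iqs => t /f0 ft; field; rewrite ft.
  - exact: integD.
have d2 : 0 < d / 2 by rewrite divr_gt0.
move=> H; rewrite -(ler_pM2r d2); apply: le_trans H _.
rewrite le_eqVlt; apply/orP; left; apply/eqP; field.
by rewrite gt_eqF.
Qed.

(** The multiples of [s] cut [[0, l]] into cells of length [s] and a shorter last one. The right end
    of that last cell is [l] itself, hence the separate condition at [l]. *)
Lemma wirtinger_grid s l f g : 0 < s -> 0 <= l -> h1 0 l f g ->
  (forall j : nat, j%:R * s <= l -> f (j%:R * s) = 0) -> f l = 0 ->
  (pi / s) ^+ 2 * Int 0 l (fun x => f x ^+ 2) <= Int 0 l (fun x => g x ^+ 2).
Proof.
move=> s0 l0 fg fj fl.
have P a b : 0 <= a -> a <= b -> b <= l -> b - a <= s -> f a = 0 -> f b = 0 ->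
   (pi / s) ^+ 2 * Int a b (fun x => f x ^+ 2) <= Int a b (fun x => g x ^+ 2).
  move=> a0 ab bl bas fa fb; apply: wirtinger => //; first exact: h1S fg _ _.
    by rewrite divr_ge0 ?pi_ge0 ?ltW.
  by rewrite mulrAC ler_pdivrMr// ler_wpM2l// pi_ge0.
have [_ i2] := fg.2; have [_ i1] := h1_sqi fg.
have A a b c : 0 <= a -> a <= b -> b <= c -> c <= l ->
   (pi / s) ^+ 2 * Int a b (fun x => f x ^+ 2) <= Int a b (fun x => g x ^+ 2) ->
   (pi / s) ^+ 2 * Int b c (fun x => f x ^+ 2) <= Int b c (fun x => g x ^+ 2) ->
   (pi / s) ^+ 2 * Int a c (fun x => f x ^+ 2) <= Int a c (fun x => g x ^+ 2).
  move=> a0 ab bc cl H1 H2.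
  rewrite !(@Int_cat _ a c b)//; [|exact: (integS i2)|exact: (integS i1)].
  by rewrite mulrDr lerD.
have G (j : nat) : j%:R * s <= l -> (pi / s) ^+ 2 * Int 0 (j%:R * s) (fun x => f x ^+ 2)
    <= Int 0 (j%:R * s) (fun x => g x ^+ 2).
  elim: j => [|j IH] jl; first by rewrite mul0r !Int_same mulr0.
  have js : j%:R * s <= j.+1%:R * s by rewrite ler_wpM2r ?(ltW s0)// ler_nat.
  have jl' := le_trans js jl.
  have j0 : 0 <= j%:R * s by rewrite mulr_ge0// ltW.
  apply: (A _ (j%:R * s)) => //; first exact: IH.
  by apply: P => //; [rewrite -natr1 mulrDl mul1r addrAC subrr add0r|exact: fj|exact: fj].
pose j := Num.trunc (l / s).
have jl : j%:R * s <= l by rewrite -ler_pdivlMr// truncn_le// divr_ge0// ltW.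
have lj : l < j.+1%:R * s by rewrite -ltr_pdivrMr// truncnS_gt.
apply: (A _ (j%:R * s)) => //; [by rewrite mulr_ge0// ltW|exact: G|].
apply: P => //; [by rewrite mulr_ge0// ltW| |exact: fj].
by rewrite -natr1 mulrDl mul1r in lj; lra.
Qed.

End one_dimensional_inequalities.

(** * Reduction to real functions *)

Section real_parts.
Context {R : realType}.
Implicit Types (a b c d l x y k : R) (f g h q : R -> R).
Local Notation Re := complex.Re.
Local Notation Im := complex.Im.

Lemma Re_cmul_conj (u v : R[i]) : Re (u * v^*) = Re u * Re v + Im u * Im v.
Proof. by case: u v => [a b] [c d] /=; ring. Qed.

(** A derivative of a real function is a priori complex, but its imaginary part has a vanishing
    primitive and is therefore zero almost everywhere. *)
Lemma h1_of_complex l f (G : R -> R[i]) :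
  is_H1_derivative l (fun x => (f x)%:C%C) G ->
  h1 0 l f (fun x => Re (G x)) /\
  {ae lebesgue_measure, forall x, 0 <= x <= l -> Im (G x) = 0}.
Proof.
move=> [[mR mI sG] fE].
have S (F : R[i] -> R) : measurable_fun `[0, l] (fun x => F (G x)) ->
    (forall z, F z ^+ 2 <= Re z ^+ 2 + Im z ^+ 2) -> sqi 0 l (fun x => F (G x)).
  move=> mF FE; split=> //; apply: (@integ_le _ _ _ _ (fun x => Re (G x) ^+ 2 + Im (G x) ^+ 2)).
  - exact: measurable_funX.
  - by move=> x _; rewrite ger0_norm ?sqr_ge0.
  - apply/integrableP; split.
      by apply/measurable_EFinP/measurable_funD; exact: measurable_funX.
    apply: le_lt_trans sG; apply: ge0_le_integral => //.
    + apply/measurable_EFinP/measurableT_comp => //.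
      by apply/measurable_funD; exact: measurable_funX.
    + by apply/measurable_EFinP/measurable_funD; exact: measurable_funX.
    + by move=> x _ /=; rewrite lee_fin ger0_norm// addr_ge0 ?sqr_ge0.
have sR : sqi 0 l (fun x => Re (G x)) by apply: S => // z; rewrite lerDl sqr_ge0.
have sI : sqi 0 l (fun x => Im (G x)) by apply: S => // z; rewrite lerDr sqr_ge0.
split.
  split=> //; split; first exact: sqi_integ.
  by move=> x xl; have := fE x; rewrite in_itv/= => /(_ xl) /(congr1 (@complex.Re R)) /=.
apply: prim_unique; first exact: sqi_integ.
move=> x xl; have := fE x; rewrite in_itv/= => /(_ xl) /(congr1 (@complex.Im R)) /=.
by rewrite add0r => /esym.
Qed.

Lemma square_integrable_real l f : sqi 0 l f ->
  square_integrable `[0, l] (fun x => (f x)%:C%C).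
Proof.
move=> [mf sf]; split=> //=.
under eq_integral do rewrite expr0n addr0.
case/integrableP: sf => _; apply: le_lt_trans; apply: ge0_le_integral => //.
- by move=> x _; rewrite lee_fin sqr_ge0.
- by apply/measurable_EFinP; exact: measurable_funX.
- by apply/measurable_EFinP/measurableT_comp => //; exact: measurable_funX.
- by move=> x _ /=; rewrite lee_fin ler_norm.
Qed.

Lemma complex_of_h1 l f g : h1 0 l f g ->
  is_H1_derivative l (fun x => (f x)%:C%C) (fun x => (g x)%:C%C).
Proof.
move=> [[gi fE] sg]; split; first exact: square_integrable_real.
move=> x; rewrite in_itv/= => xl; apply/eqP; rewrite eq_complex /=.
by rewrite {1}fE// eqxx/= Rintegral_cst// mul0r addr0.
Qed.

Lemma H1_of_h1 l f g : h1 0 l f g -> H1 l (fun x => (f x)%:C%C).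
Proof. by move=> fg; exists (fun x => (g x)%:C%C); exact: complex_of_h1. Qed.

(** [H1_derivative] is an arbitrary choice among the derivatives; this compares it with a known one,
    so that forms can be computed with explicit derivatives. *)
Lemma H1_derivative_ae l f g : h1 0 l f g ->
  let D := H1_derivative l (fun x => (f x)%:C%C) in
  [/\ measurable_fun `[0, l] (fun x => Re (D x)),
      measurable_fun `[0, l] (fun x => Im (D x)) &
      {ae lebesgue_measure, forall x, 0 <= x <= l -> Re (D x) = g x /\ Im (D x) = 0}].
Proof.
move=> fg D; have HD : is_H1_derivative l (fun x => (f x)%:C%C) D.
  by apply: (@xgetPex _ (fun=> 0)); exact: H1_of_h1 fg.
have [fD I0] := h1_of_complex HD; case: (HD) => -[mR mI _] _.
split=> //.
have i1 := prim_integ fD.1; have i2 := prim_integ fg.1.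
have : {ae lebesgue_measure, forall x, 0 <= x <= l -> Re (D x) - g x = 0}.
  apply: prim_unique; first exact: integB.
  move=> x /andP[x0 xl]; rewrite IntB; [|exact: (integS i1)|exact: (integS i2)].
  by rewrite -(prim_diff fD.1)// -(prim_diff fg.1)// subrr.
move: I0; apply: (@filterS2 _ _ (ae_filter_ringOfSetsType lebesgue_measure)).
by move=> x I0 R0 xl; split; [apply/eqP; rewrite -subr_eq0 R0|exact: I0].
Qed.

Lemma form_real l f f' g g' q : h1 0 l f f' -> h1 0 l g g' -> integ 0 l q ->
  Re (Cintegral `[0, l] (fun x =>
    H1_derivative l (fun x => (f x)%:C%C) x * (H1_derivative l (fun x => (g x)%:C%C) x)^*
    + (q x)%:C%C * (f x)%:C%C * ((g x)%:C%C)^*)) =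
  Int 0 l (fun x => f' x * g' x + q x * f x * g x).
Proof.
move=> ff gg iq; rewrite /=.
have [mRf mIf aef] := H1_derivative_ae ff; have [mRg mIg aeg] := H1_derivative_ae gg.
have mq := integ_meas iq.
have mf := cont_meas (h1_cont ff); have mg := cont_meas (h1_cont gg).
have [_ [mf' _]] := ff; have [_ [mg' _]] := gg.
set D1 := H1_derivative l _ in mRf mIf aef *.
set D2 := H1_derivative l _ in mRg mIg aeg *.
rewrite -[LHS]/(Int _ _ _).
rewrite (@eq_Int _ _ _ _ (fun x =>
    Re (D1 x) * Re (D2 x) + Im (D1 x) * Im (D2 x) + q x * f x * g x)).
  apply: eq_Int_ae.
  - by do !(apply: measurable_funD || apply: measurable_funM).
  - by do !(apply: measurable_funD || apply: measurable_funM).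
  - move: aef aeg; apply: (@filterS2 _ _ (ae_filter_ringOfSetsType lebesgue_measure)).
    by move=> x Hf Hg xl; have [-> ->] := Hf xl; have [-> ->] := Hg xl; rewrite mulr0 addr0.
by move=> x _; rewrite raddfD/= -Re_cmul_conj; congr +%R; rewrite /=; ring.
Qed.

End real_parts.

Section graph_reduction.
Context {R : realType} (G : metric_graph R).
Local Notation gfun := (edge G -> R -> R).
Implicit Types (f g h : gfun).
Local Notation Re := complex.Re.
Local Notation Im := complex.Im.

Definition dotR f g : R := \sum_e Int 0 (ell e) (fun x => f e x * g e x).

Definition endv f (i : edge G * bool) : R := f i.1 (end_coord i).

Lemma L2dot_real f g : L2dot (of_real f) (of_real g) = (dotR f g)%:C%C.
Proof.
apply/eqP; rewrite eq_complex /= /L2dot !raddf_sum/=; apply/andP; split.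
  apply/eqP; apply: eq_bigr => e _; apply: eq_Int => x _; rewrite /=; ring.
rewrite big1// => e _; rewrite -[RHS](Int0 0 (ell e)).
by apply: eq_Int => x _ /=; ring.
Qed.

Variables (q : edge G -> R -> R) (B : 'M[R[i]]_#|{: edge G * bool}|).

Definition vertR f g : R :=
  \sum_i \sum_j Re (B (enum_rank i) (enum_rank j)) * endv f j * endv g i.

Lemma Re_vertex_form f g :
  Re (vertex_form B (of_real f) (of_real g)) = vertR f g.
Proof.
rewrite /vertex_form /vertR.
transitivity (Re (\sum_i \sum_j B (enum_rank i) (enum_rank j) *
    boundary_value (of_real f) j * (boundary_value (of_real g) i)^*)).
  congr Re; rewrite [RHS](partition_big (@vtx _ G) predT)//=; apply: eq_bigr => u _.
  rewrite exchange_big/=; apply: eq_bigr => i _.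
  by rewrite [RHS](partition_big (@vtx _ G) predT).
rewrite raddf_sum; apply: eq_bigr => i _; rewrite raddf_sum; apply: eq_bigr => j _.
by rewrite /= /boundary_value /of_real; case: (B _ _) => a b /=; rewrite /endv; ring.
Qed.

(** The derivatives are arguments, so that test functions bring their own instead of the chosen
    [H1_derivative]. *)
Definition formR f f' g g' : R :=
  \sum_e Int 0 (ell e) (fun x => f' e x * g' e x + q e x * f e x * g e x) + vertR f g.

Lemma Re_sesq_form f f' g g' :
  (forall e, integ 0 (ell e) (q e)) ->
  (forall e, h1 0 (ell e) (f e) (f' e)) -> (forall e, h1 0 (ell e) (g e) (g' e)) ->
  Re (sesq_form q B (of_real f) (of_real g)) = formR f f' g g'.
Proof.
move=> iq ff gg; rewrite /sesq_form raddfD/= Re_vertex_form raddf_sum; congr +%R.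
by apply: eq_bigr => e _; apply: form_real.
Qed.

End graph_reduction.

(** * Rayleigh quotients and Weyl's law *)

Section spectral.
Context {R : realType} (V : lmodType R) (D : V -> Prop) (a : V -> V -> R).
Hypothesis D0 : D 0.
Hypothesis DD : forall k u v, D u -> D v -> D (k *: u + v).
Hypothesis aC : forall u v, D u -> D v -> a u v = a v u.
Hypothesis aD : forall k u v w, D u -> D v -> D w ->
  a (k *: u + v) w = k * a u w + a v w.

Let a0l w : D w -> a 0 w = 0.
Proof.
move=> Dw; have := aD 1 D0 D0 Dw; rewrite scale1r addr0 mul1r => H; lra.
Qed.

Lemma dom_sum (I : finType) (c : I -> R) (u : I -> V) :
  (forall i, D (u i)) -> D (\sum_i c i *: u i).
Proof. by move=> Du; elim/big_rec: _ => // i v _; exact: DD. Qed.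

Lemma form_suml (I : finType) (c : I -> R) (u : I -> V) w :
  (forall i, D (u i)) -> D w ->
  a (\sum_i c i *: u i) w = \sum_i c i * a (u i) w.
Proof.
move=> Du Dw.
suff [] : D (\sum_i c i *: u i) /\
    a (\sum_i c i *: u i) w = \sum_i c i * a (u i) w by [].
elim/big_rec2: _ => [|i x v _ [Dv E]]; first by rewrite a0l.
by split; [exact: DD|rewrite aD// E].
Qed.

Lemma form_sum_orthogonal (I : finType) (c : I -> R) (u : I -> V) :
  (forall i, D (u i)) -> (forall i j, i != j -> a (u i) (u j) = 0) ->
  a (\sum_i c i *: u i) (\sum_i c i *: u i) = \sum_i c i ^+ 2 * a (u i) (u i).
Proof.
move=> Du uu; rewrite form_suml//; last exact: dom_sum.
apply: eq_bigr => i _; rewrite aC//; last exact: dom_sum.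
rewrite form_suml// (bigD1 i)//= big1 ?addr0.
  by ring.
by move=> j ji; rewrite uu ?mulr0.
Qed.

Lemma form_subZ k u v : D u -> D v ->
  a (u - k *: v) (u - k *: v) = a u u - 2 * k * a v u + k ^+ 2 * a v v.
Proof.
move=> Du Dv; have Dw : D (- k *: v + u) by exact: DD.
rewrite addrC -scaleNr aD// [in X in X + _]aC// [in X in _ + X]aC// !aD//.
by rewrite (aC Du Dv); ring.
Qed.

End spectral.

(** * The two halves of the min-max principle *)

Section rayleigh.
Context {R : realType} (V : lmodType R) (D : V -> Prop) (a d : V -> V -> R).
Hypothesis D0 : D 0.
Hypothesis DD : forall k u v, D u -> D v -> D (k *: u + v).
Hypothesis aC : forall u v, D u -> D v -> a u v = a v u.
Hypothesis aD : forall k u v w, D u -> D v -> D w ->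
  a (k *: u + v) w = k * a u w + a v w.
Hypothesis dC : forall u v, D u -> D v -> d u v = d v u.
Hypothesis dD : forall k u v w, D u -> D v -> D w ->
  d (k *: u + v) w = k * d u w + d v w.
Variables (lambda : nat -> R) (psi : nat -> V).
Hypothesis lambda_homo : {homo lambda : m n / (m <= n)%N >-> m <= n}.
Hypothesis Dpsi : forall n, D (psi n).
Hypothesis psi_eigen : forall n v, D v -> a (psi n) v = lambda n * d (psi n) v.
Hypothesis psi_on : forall m n, d (psi m) (psi n) = (m == n)%:R.

(** Orthonormality diagonalizes both forms on the span, so the Rayleigh quotient is a weighted mean
    of [lambda 0], ..., [lambda n]. The second part shows that a nontrivial combination has positive
    norm. *)
Lemma rayleigh_le n (c : 'I_n.+1 -> R) (f := \sum_i c i *: psi i) :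
  a f f <= lambda n * d f f /\ d f f = \sum_i c i ^+ 2.
Proof.
have Df : forall i : 'I_n.+1, D (psi i) by move=> i; exact: Dpsi.
have on i j : i != j -> d (psi (i : 'I_n.+1)) (psi (j : 'I_n.+1)) = 0.
  by rewrite psi_on => /negbTE ij; rewrite (inj_eq val_inj) ij.
have dE : d f f = \sum_i c i ^+ 2.
  rewrite /f (form_sum_orthogonal D0 DD dC dD)//.
  by apply: eq_bigr => i _; rewrite psi_on eqxx mulr1.
split=> //; rewrite dE /f (form_sum_orthogonal D0 DD aC aD)//; last first.
  by move=> i j ij; rewrite psi_eigen// on// mulr0.
rewrite mulr_sumr; apply: ler_sum => i _.
rewrite psi_eigen// psi_on eqxx mulr1 mulrC ler_wpM2r ?sqr_ge0//.
by apply: lambda_homo; rewrite -ltnS.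
Qed.

(* With the Fourier remainders [r N], the quantity [a (r N) - lambda n d (r N)]
   decreases in [N] and is eventually bounded below by a null sequence. *)
Lemma rayleigh_ge n f (C : R) : D f ->
  (forall k, (k < n)%N -> d f (psi k) = 0) ->
  (forall u, D u -> - C * d u u <= a u u) ->
  (let r N := f - \sum_(k < N) d f (psi k) *: psi k in
   d (r N) (r N) @[N --> \oo] --> (0 : R)) ->
  lambda n * d f f <= a f f.
Proof.
move=> Df ortho lb /= rcv.
pose r N := f - \sum_(k < N) d f (psi k) *: psi k.
have Ds N : D (\sum_(k < N) d f (psi k) *: psi k) by exact: dom_sum.
have Dr N : D (r N).
  by rewrite /r addrC -scaleN1r; exact: DD.
have rS N : r N.+1 = r N - d f (psi N) *: psi N.
  by rewrite /r big_ord_recr/= opprD addrA.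
have dr N : d (psi N) (r N) = d f (psi N).
  rewrite dC// /r addrC -scaleN1r dD// (form_suml D0 DD dD)//.
  rewrite big1 ?mulr0 ?add0r// => i _.
  by rewrite psi_on ltn_eqF ?mulr0.
pose E N := a (r N) (r N) - lambda n * d (r N) (r N).
have ES N : E N.+1 <= E N.
  rewrite /E rS (form_subZ DD aC aD)// (form_subZ DD dC dD)//.
  rewrite psi_eigen// psi_eigen// dr psi_on eqxx !mulr1.
  (* For [N < n] the coefficient vanishes and [E] does not change; from [n] on it drops by
     [(lambda N - lambda n) d(f, psi N)^2]. *)
  have [Nn|nN] := ltnP N n; first by rewrite ortho//; lra.
  rewrite -subr_ge0.
  have : 0 <= (lambda N - lambda n) * d f (psi N) ^+ 2.
    by rewrite mulr_ge0 ?sqr_ge0// subr_ge0 lambda_homo.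
  by congr (_ <= _); ring.
have E0 N : E N <= E 0%N by elim: N => // N; exact: le_trans (ES N).
(* Completeness gives convergence of the remainders in L^2 only. Semi-boundedness stands in for
   convergence in the form norm: [a (r N) (r N)] is at least [- C] times a null sequence. *)
have EN N : - (C + lambda n) * d (r N) (r N) <= E 0%N.
  apply: le_trans (E0 N); rewrite /E; have := lb _ (Dr N); lra.
have : 0 <= E 0%N.
  have cv : (- (C + lambda n) * d (r N) (r N)) @[N --> \oo] --> (- (C + lambda n) * 0 : R).
    exact: cvgMr.
  rewrite mulr0 in cv.
  have cvE := cvg_lim (@Rhausdorff R) cv.
  rewrite -cvE; apply: limr_le; first by apply/cvg_ex; exists 0.
  by apply: nearW.
by rewrite /E /r big_ord0 subr0 subr_ge0.
Qed.

End rayleigh.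

(** More unknowns than equations. This supplies the trial functions for both halves of Weyl's law:
    vanishing at grid points for one, orthogonality to eigenfunctions for the other. *)
Lemma exists_kernel (R : fieldType) (S T : finType) (phi : S -> T -> R) :
  (#|T| < #|S|)%N ->
  exists c : S -> R, (exists s, c s != 0) /\ forall t, \sum_s c s * phi s t = 0.
Proof.
move=> TS; pose A : 'M[R]_(#|S|, #|T|) := \matrix_(i, j) phi (enum_val i) (enum_val j).
have : kermx A != 0.
  rewrite -mxrank_eq0 mxrank_ker subn_eq0 -ltnNge.
  exact: leq_ltn_trans (rank_leq_col A) TS.
move=> /rowV0Pn[v vker v0].
have vA : v *m A = 0 by apply/sub_kermxP.
exists (fun s => v 0 (enum_rank s)); split.
  have /rV0Pn[i vi] := v0; exists (enum_val i); by rewrite enum_valK.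
move=> t; have vAt : (v *m A) 0 (enum_rank t) = 0 by rewrite vA mxE.
rewrite -[RHS]vAt mxE [RHS](reindex (@enum_rank S))/=; last first.
  by apply: onW_bij; exact: enum_rank_bij.
by apply: eq_bigr => s _; rewrite mxE !enum_rankK.
Qed.

Lemma ler_sum_term (R : realType) (I : finType) (F : I -> R) i :
  (forall j, 0 <= F j) -> F i <= \sum_j F j.
Proof. by move=> F0; rewrite (bigD1 i)//= lerDl sumr_ge0. Qed.

(** * The real quadratic form on the graph and its lower bound *)

Section graph_forms.
Context {R : realType} (G : metric_graph R).
Variables (q : edge G -> R -> R) (B : 'M[R[i]]_#|{: edge G * bool}|).
Variables (w : edge G * bool -> R) (V0 : {set vertex G}).
Hypothesis q_integ : forall e, integ 0 (ell e) (q e).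
Hypothesis q_ge0 : forall e,
  {ae lebesgue_measure, forall x, 0 <= x <= ell e -> 0 <= q e x}.
Hypothesis B_hermitian : B \is hermsymmx.

Local Notation gfun := (edge G -> R -> R^o).
(* Elements of [V] are pairs of a function and its derivative. *)
Local Notation V := (gfun * gfun)%type.
Implicit Types u v : V.

(** The real counterpart of [form_domain]. As the derivative is a component of the pair, linear
    combinations act on it exactly, and [formV] is bilinear on [dom] without null-set
    corrections. *)
Definition dom u : Prop :=
  [/\ forall e, h1 0 (ell e) (u.1 e) (u.2 e),
      forall i j, vtx i = vtx j -> vtx i \notin V0 ->
        w i * endv u.1 i = w j * endv u.1 j &
      forall i, vtx i \in V0 -> endv u.1 i = 0].

Lemma comb1E k u v e (x : R) :
  (k *: u + v).1 e x = k * (u.1 e x : R) + (v.1 e x : R).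
Proof. by []. Qed.

Lemma comb2E k u v e (x : R) :
  (k *: u + v).2 e x = k * (u.2 e x : R) + (v.2 e x : R).
Proof. by []. Qed.

Lemma endv_comb k u v i :
  endv (k *: u + v).1 i = k * endv u.1 i + endv v.1 i.
Proof. by []. Qed.

Definition formV u v : R := formR q B u.1 u.2 v.1 v.2.
Definition dotV u v : R := dotR u.1 v.1.

Lemma dom_h1 u e : dom u -> h1 0 (ell e) (u.1 e) (u.2 e).
Proof. by case. Qed.

(** The vertex conditions hold trivially when all boundary values are zero. The sine arches and all
    test functions localized in an edge enter the form domain this way. *)
Lemma dom_vanish u : (forall e, h1 0 (ell e) (u.1 e) (u.2 e)) ->
  (forall i, endv u.1 i = 0) -> dom u.
Proof. by move=> hu u0; split=> // i j *; rewrite !u0 !mulr0. Qed.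

Lemma dom0 : dom 0.
Proof. by apply: dom_vanish => // e; exact: h1_cst. Qed.

Lemma domD k u v : dom u -> dom v -> dom (k *: u + v).
Proof.
move=> [hu wu zu] [hv wv zv]; split.
- by move=> e; exact: h1D (h1Z k (hu e)) (hv e).
- move=> i j ij iV; rewrite !endv_comb !mulrDr !(mulrCA _ k).
  by rewrite (wu _ _ ij iV) (wv _ _ ij iV).
- by move=> i iV; rewrite endv_comb zu ?zv// mulr0 addr0.
Qed.

Lemma dotVC u v : dotV u v = dotV v u.
Proof. by apply: eq_bigr => e _; apply: eq_Int => x _; rewrite mulrC. Qed.

Lemma dotVD k u v x : dom u -> dom v -> dom x ->
  dotV (k *: u + v) x = k * dotV u x + dotV v x.
Proof.
move=> Du Dv Dx.
have E e : Int 0 (ell e) (fun t => (k *: u + v).1 e t * x.1 e t) =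
    k * Int 0 (ell e) (fun t => u.1 e t * x.1 e t) +
    Int 0 (ell e) (fun t => v.1 e t * x.1 e t).
  have su := h1_sqi (dom_h1 e Du); have sv := h1_sqi (dom_h1 e Dv).
  have sx := h1_sqi (dom_h1 e Dx).
  have iu := sqiM su sx; have iv := sqiM sv sx.
  rewrite -IntZ// -IntD//; last exact: integZ.
  by apply: eq_Int => t _; rewrite comb1E; ring.
by rewrite /dotV /dotR mulr_sumr -big_split; apply: eq_bigr => e _; exact: E.
Qed.

Lemma integ_form u v e : dom u -> dom v ->
  integ 0 (ell e) (fun x => u.2 e x * v.2 e x + q e x * u.1 e x * v.1 e x).
Proof.
move=> Du Dv; have hu := dom_h1 e Du; have hv := dom_h1 e Dv.
apply: integD; first by apply: sqiM; [case: hu|case: hv].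
apply: eq_integ (integM_cont (h1_cont hu) (integM_cont (h1_cont hv) (q_integ e))).
by move=> x _; ring.
Qed.

Lemma formVC u v : formV u v = formV v u.
Proof.
rewrite /formV /formR; congr +%R.
  by apply: eq_bigr => e _; apply: eq_Int => x _; ring.
rewrite /vertR exchange_big; apply: eq_bigr => i _; apply: eq_bigr => j _ /=.
have -> : complex.Re (B (enum_rank j) (enum_rank i)) =
          complex.Re (B (enum_rank i) (enum_rank j)).
  move/is_hermitianmxP: B_hermitian => /matrixP/(_ (enum_rank j) (enum_rank i)).
  by rewrite !mxE expr0 mul1r => ->; case: (B _ _).
by ring.
Qed.

Lemma formVD k u v x : dom u -> dom v -> dom x ->
  formV (k *: u + v) x = k * formV u x + formV v x.
Proof.
move=> Du Dv Dx; rewrite /formV /formR mulrDr addrACA.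
have E e : Int 0 (ell e) (fun t => (k *: u + v).2 e t * x.2 e t +
      q e t * (k *: u + v).1 e t * x.1 e t) =
    k * Int 0 (ell e) (fun t => u.2 e t * x.2 e t + q e t * u.1 e t * x.1 e t) +
    Int 0 (ell e) (fun t => v.2 e t * x.2 e t + q e t * v.1 e t * x.1 e t).
  have iu := integ_form e Du Dx; have iv := integ_form e Dv Dx.
  rewrite -IntZ// -IntD//; last exact: integZ.
  by apply: eq_Int => t _; rewrite comb1E comb2E; ring.
congr +%R.
  by rewrite mulr_sumr -big_split; apply: eq_bigr => e _; exact: E.
rewrite /vertR mulr_sumr -big_split; apply: eq_bigr => i _.
rewrite [X in _ = X]/= mulr_sumr -big_split; apply: eq_bigr => j _.
by rewrite endv_comb /=; ring.
Qed.

Lemma Int_q_ge0 u e : dom u ->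
  0 <= Int 0 (ell e) (fun x => q e x * u.1 e x * u.1 e x).
Proof.
move=> Du; have hu := h1_cont (dom_h1 e Du); apply: Int_ge0_ae.
  apply: eq_integ (integM_cont hu (integM_cont hu (q_integ e))).
  by move=> x _; ring.
apply: (@filterS _ _ (ae_filter_ringOfSetsType lebesgue_measure)) (q_ge0 e).
by move=> x qx /qx {}qx; rewrite -mulrA mulr_ge0// -expr2 sqr_ge0.
Qed.

Lemma formV_ge u : dom u ->
  \sum_e Int 0 (ell e) (fun x => u.2 e x ^+ 2) + vertR B u.1 u.1 <= formV u u.
Proof.
move=> Du; rewrite lerD2r; apply: ler_sum => e _.
have iq : integ 0 (ell e) (fun x => q e x * u.1 e x * u.1 e x).
  have hu := h1_cont (dom_h1 e Du).
  by apply: eq_integ (integM_cont hu (integM_cont hu (q_integ e))) => x _; ring.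
have [_ [_ s2]] := dom_h1 e Du.
by rewrite IntD// lerDl Int_q_ge0.
Qed.

(** The vertex form is at least [- b] times the sum of the squared boundary values. The trace
    inequality turns these into energy with coefficient [2 * eps], the 2 counting the ends of an
    edge; [eps] satisfies [2 * b * eps <= 1], so the energy absorbs this part. *)
Lemma formV_lower_bound : exists C : R, forall u, dom u ->
  - C * dotV u u <= formV u u.
Proof.
pose b : R := \sum_i \sum_j `|complex.Re (B (enum_rank i) (enum_rank j))|.
have b0 : 0 <= b by do 2 (apply: sumr_ge0 => ? _).
pose eps : R := (2 * (b + 1))^-1.
have eps0 : 0 < eps by rewrite invr_gt0; lra.
have beps : 2 * b * eps <= 1 by rewrite ler_pdivrMr; lra.
pose K : R := \sum_(e : edge G) (eps^-1 + (ell e)^-1 : R).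
have Ke (e : edge G) : 0 <= eps^-1 + (ell e)^-1.
  by rewrite addr_ge0// invr_ge0 ltW// ell_gt0.
have KK (e : edge G) : eps^-1 + (ell e)^-1 <= K.
  exact: (ler_sum_term e Ke).
exists (2 * b * K) => u Du.
apply: le_trans (formV_ge Du).
pose S := \sum_i (endv u.1 i : R) ^+ 2.
have xS i : (endv u.1 i : R) ^+ 2 <= S.
  by apply: (@ler_sum_term R _ (fun i => (endv u.1 i : R) ^+ 2)) => j; exact: sqr_ge0.
have vS : - b * S <= vertR B u.1 u.1.
  rewrite mulNr lerNl /vertR -sumrN mulr_suml; apply: ler_sum => i _.
  rewrite -sumrN mulr_suml; apply: ler_sum => j _.
  set r := complex.Re _; apply: le_trans (ler_norm _) _.
  rewrite normrN -mulrA normrM ler_wpM2l//.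
  have := xS i; have := xS j.
  set y := endv _ j; set z := endv _ i => H1 H2.
  rewrite ler_norml; have := sqr_ge0 (y - z); have := sqr_ge0 (y + z); nra.
have SE : S <= \sum_e (2 * (eps * Int 0 (ell e) (fun x => u.2 e x ^+ 2) +
      K * Int 0 (ell e) (fun x => u.1 e x ^+ 2))).
  rewrite /S -(pair_bigA _ (fun e b => (endv u.1 (e, b) : R) ^+ 2))/=.
  apply: ler_sum => e _; rewrite big_bool/=.
  have hu := dom_h1 e Du.
  have Tr c : c = 0 \/ c = ell e -> u.1 e c ^+ 2 <= eps * Int 0 (ell e) (fun x => u.2 e x ^+ 2) +
      K * Int 0 (ell e) (fun x => u.1 e x ^+ 2).
    move=> cE; apply: le_trans (trace (ell_gt0 e) hu eps0 cE) _.
    rewrite subr0 lerD2l; apply: ler_wpM2r; last exact: KK.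
    by apply: Int_ge0 => x _; exact: sqr_ge0.
  have := Tr _ (or_introl erefl); have := Tr _ (or_intror erefl).
  rewrite /endv /end_coord/=; lra.
have dE : dotV u u = \sum_e Int 0 (ell e) (fun x => u.1 e x ^+ 2).
  by apply: eq_bigr => e _; apply: eq_Int => x _.
move: SE; rewrite -mulr_sumr big_split/= -!mulr_sumr -dE.
set A := \sum_e _; move=> SE.
have A0 : 0 <= A.
  by apply: sumr_ge0 => e _; apply: Int_ge0 => x _; exact: sqr_ge0.
have d0 : 0 <= dotV u u.
  by rewrite dE; apply: sumr_ge0 => e _; apply: Int_ge0 => x _; exact: sqr_ge0.
have : b * S <= b * (2 * (eps * A + K * dotV u u)) by rewrite ler_wpM2l.
have : 2 * b * eps * A <= 1 * A by rewrite ler_wpM2r.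
lra.
Qed.

End graph_forms.

(** * Weyl bounds for the eigenvalues *)

Section eigenbasis.
Context {R : realType} (G : metric_graph R).
Variables (q : edge G -> R -> R) (B : 'M[R[i]]_#|{: edge G * bool}|).
Variables (w : edge G * bool -> R) (V0 : {set vertex G}).
Hypothesis q_integ : forall e, integ 0 (ell e) (q e).
Hypothesis q_ge0 : forall e,
  {ae lebesgue_measure, forall x, 0 <= x <= ell e -> 0 <= q e x}.
Hypothesis B_hermitian : B \is hermsymmx.
Variables (lambda : nat -> R) (psi : nat -> edge G -> R -> R).
Hypothesis psi_basis : ordered_real_eigenbasis q B w V0 lambda psi.

Local Notation gfun := (edge G -> R -> R^o).
Local Notation V := (gfun * gfun)%type.
Local Notation dom := (@dom R G w V0).
Local Notation formV := (@formV R G q B).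
Local Notation dotV := (@dotV R G).
Local Notation Re := complex.Re.

Definition Psi n : V :=
  (psi n, fun e x => Re (H1_derivative (ell e) (of_real (psi n) e) x)).

Lemma Psi_dom n : dom (Psi n).
Proof.
have [_ /(_ n)[[H wc zc] _ _] _] := psi_basis; split => [e|i j ij iV|i iV].
- have HD : is_H1_derivative (ell e) (of_real (psi n) e)
      (H1_derivative (ell e) (of_real (psi n) e)).
    by apply: (@xgetPex _ (fun=> 0)); exact: H.
  by have [] := h1_of_complex HD.
- have /(congr1 (@complex.Re R)) := wc _ _ ij iV.
  by rewrite /boundary_value /of_real/= !mulr0 !subr0.
- by have /(congr1 (@complex.Re R)) := zc _ iV.
Qed.

Lemma form_domain_real v : dom v -> form_domain w V0 (of_real v.1).
Proof.
move=> [hv wc zc]; split => [e|i j ij iV|i iV].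
- exact: H1_of_h1 (hv e).
- have := wc _ _ ij iV; rewrite /endv /boundary_value /of_real => E.
  by rewrite -!rmorphM/= E.
- have := zc _ iV; rewrite /endv /boundary_value /of_real => ->.
  by [].
Qed.

Lemma lambda_homo : {homo lambda : m n / (m <= n)%N >-> m <= n}.
Proof. by case: psi_basis. Qed.

(** The real part of the weak equation against real test functions; the complex formulation is left
    behind here. *)
Lemma Psi_eigen n v : dom v -> formV (Psi n) v = lambda n * dotV (Psi n) v.
Proof.
move=> Dv; have [_ /(_ n)[_ _ /(_ _ (form_domain_real Dv)) H] _] := psi_basis.
move: H => /(congr1 (@complex.Re R)).
rewrite (Re_sesq_form B q_integ (fun e => dom_h1 e (Psi_dom n)) (fun e => dom_h1 e Dv)).
move=> E; rewrite [LHS]E.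
rewrite (_ : (fun e x => _) = of_real (fun e x => lambda n * psi n e x)); last first.
  by apply/funext => e; apply/funext => x; rewrite /of_real rmorphM.
rewrite L2dot_real/= /dotR /dotV /dotR mulr_sumr; apply: eq_bigr => e _.
rewrite -IntZ; last first.
  by apply: sqiM; [exact: h1_sqi (dom_h1 e (Psi_dom n))|exact: h1_sqi (dom_h1 e Dv)].
by apply: eq_Int => x _; rewrite mulrA.
Qed.

Lemma Psi_orthonormal m n : dotV (Psi m) (Psi n) = (m == n)%:R.
Proof.
have [_ _ [_ /(_ m n) H _]] := psi_basis.
move: H; rewrite L2dot_real => /(congr1 (@complex.Re R)) H.
by rewrite [LHS]H; case: eqP.
Qed.

Lemma sum_fstE N (c : 'I_N -> R) (u : 'I_N -> V) e (x : R) :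
  (\sum_i c i *: u i).1 e x = \sum_i c i * ((u i).1 e x : R).
Proof.
by elim/big_rec2: _ => // i y v _ <-.
Qed.

Lemma Psi_complete v : dom v ->
  (let r N := v - \sum_(k < N) dotV v (Psi k) *: Psi k in
   dotV (r N) (r N) @[N --> \oo] --> (0 : R)).
Proof.
move=> Dv r; have [_ _ [_ _ H]] := psi_basis.
have L : L2 (of_real v.1).
  by move=> e; apply: square_integrable_real; exact: h1_sqi (dom_h1 e Dv).
have := H _ L; rewrite /=; apply: cvg_trans; apply: near_eq_cvg.
apply: nearW => N.
rewrite (_ : (fun e x => _) = of_real (r N).1); first by rewrite L2dot_real.
have LE k : L2dot (of_real v.1) (of_real (psi k)) = (dotV v (Psi k))%:C%C.
  exact: L2dot_real.
apply/funext => e; apply/funext => x.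
rewrite (eq_bigr (fun k : 'I_N => (dotV v (Psi k) * psi k e x)%:C%C)); last first.
  by move=> k _; rewrite LE rmorphM.
rewrite -rmorph_sum -rmorphB; congr (_%:C%C).
rewrite [RHS](_ : _ = (v.1 e x : R) - (\sum_(k < N) dotV v (Psi k) *: Psi k).1 e x)//.
by rewrite sum_fstE.
Qed.

Lemma weyl_lower n s : 0 < s ->
  (\sum_(e : edge G) (Num.trunc (ell e / s)).+2 < n.+1)%N ->
  (pi / s) ^+ 2 <= lambda n.
Proof.
move=> s0 cnt.
pose T := {e : edge G & 'I_(Num.trunc (ell e / s)).+2}.
(* Indices up to [trunc (ell e / s)] are the grid points, starting with the end 0; the last index
   stands for the end [ell e]. This makes [trunc (ell e / s) + 2] conditions on the edge. *)
pose pt (t : T) : R := if (tagged t < (Num.trunc (ell (tag t) / s)).+1)%N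
   then (tagged t)%:R * s else ell (tag t).
have cT : (#|{: T}| < #|{: 'I_n.+1}|)%N.
  rewrite card_ord; apply: leq_ltn_trans cnt.
  rewrite card_tagged sumnE big_map big_enum/= leq_eqVlt; apply/orP; left.
  by apply/eqP; apply: eq_bigr => e _; rewrite card_ord.
have [c [[i0 ci0] cz]] := exists_kernel (fun (i : 'I_n.+1) (t : T) => psi i (tag t) (pt t)) cT.
pose f : V := \sum_i c i *: Psi i.
have Df : dom f by apply: (dom_sum (dom0 w V0) (@domD _ _ w V0)) => i; exact: Psi_dom.
have fE t : (f.1 (tag t) (pt t) : R) = 0 by rewrite sum_fstE; exact: cz.
have fj e (j : nat) : j%:R * s <= ell e -> (f.1 e (j%:R * s) : R) = 0.
  move=> jl; have jt : (j < (Num.trunc (ell e / s)).+1)%N.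
    have ls0 : 0 <= ell e / s by exact: divr_ge0 (ltW (ell_gt0 e)) (ltW s0).
    by rewrite ltnS truncn_ge_nat// ler_pdivlMr.
  have jt2 : (j < (Num.trunc (ell e / s)).+2)%N by exact: ltn_trans jt _.
  by have := fE (Tagged (fun e => 'I_(Num.trunc (ell e / s)).+2) (Ordinal jt2)); rewrite /pt/= jt.
have fl e : (f.1 e (ell e) : R) = 0.
  by have := fE (existT (fun e => 'I_(Num.trunc (ell e / s)).+2) e ord_max); rewrite /pt/= ltnn.
have endv0 i : endv f.1 i = 0.
  case: i => e [] /=; rewrite /endv /end_coord/=; first exact: fl.
  by have := fj e 0%N; rewrite mul0r ltW ?ell_gt0//; apply.
have [fle dE] := rayleigh_le (dom0 w V0) (@domD _ _ w V0) (fun u v _ _ => formVC q B_hermitian u v)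
   (formVD B q_integ) (fun u v _ _ => dotVC u v) (@dotVD _ _ w V0)
   lambda_homo Psi_dom Psi_eigen Psi_orthonormal c.
have d0 : 0 < dotV f f.
  rewrite dE (bigD1 i0)//= ltr_wpDr ?exprn_even_gt0//.
  by apply: sumr_ge0 => j _; exact: sqr_ge0.
rewrite -(ler_pM2r d0); apply: le_trans fle.
apply: le_trans (formV_ge B q_integ q_ge0 Df).
(* The vertex form is the only part that could be negative; the grid contains all edge ends in order
   to remove it. *)
have -> : vertR B f.1 f.1 = 0.
  by rewrite /vertR big1// => i _; rewrite big1// => j _; rewrite !endv0 mulr0.
rewrite addr0 mulr_sumr; apply: ler_sum => e _.
exact: wirtinger_grid s0 (ltW (ell_gt0 e)) (dom_h1 e Df) (fj e) (fl e).
Qed.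

(** * Sine arches on the full cells of the edges *)

Section bumps.
Variable s : R.
Hypothesis s0 : 0 < s.
Local Notation T := {e : edge G & 'I_(Num.trunc (ell e / s))}.
Let k := pi / s.
Let left (t : T) : R := (tagged t)%:R * s.

(** The index [j] of an edge stands for the cell from [j s] to [(j + 1) s]. Only full cells are
    used, so every arch vanishes at both ends of its edge. *)
Definition bump (t : T) : V :=
  (fun e x => if e == tag t then
     ext (left t) (left t + s) (fun x => sin (k * (x - left t))) x else 0,
   fun e x => if e == tag t then
     ext (left t) (left t + s) (fun x => k * cos (k * (x - left t))) x else 0).

Let left_ge0 t : 0 <= left t.
Proof. by rewrite mulr_ge0// ltW. Qed.

Let left_le t : left t <= left t + s.
Proof. by rewrite lerDl ltW. Qed.

Let left_ell t : left t + s <= ell (tag t).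
Proof.
rewrite /left -[X in _ + X]mul1r -mulrDl natr1 -ler_pdivlMr//.
have lt := ltn_ord (tagged t).
apply: le_trans (_ : (Num.trunc (ell (tag t) / s))%:R <= _); first by rewrite ler_nat.
by rewrite truncn_le divr_ge0// ltW// ell_gt0.
Qed.

Lemma bump_endv t i : endv (bump t).1 i = 0.
Proof.
case: i => e b; rewrite /endv /end_coord/=; case: eqP => [->|//]; case: b => /=.
  by rewrite /ext ltNge left_ell andbF.
rewrite /ext; case: ifP => // /andP[l0 _].
have -> : left t = 0 by apply/le_anti; rewrite l0 left_ge0.
by rewrite subrr mulr0 sin0.
Qed.

Lemma bump_dom t : dom (bump t).
Proof.
apply: dom_vanish => [e|]; last exact: bump_endv.
  rewrite /bump/=.
  have [->|_] := eqVneq e (tag t); last exact: h1_cst.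
  apply: h1_ext => //; first exact: h1_sin.
    by rewrite subrr mulr0 sin0.
  rewrite (_ : k * _ = pi) ?sinpi// /k; field; by rewrite gt_eqF.
Qed.

Let disj t t' (f g : R -> R) e x : t != t' ->
  (if e == tag t then ext (left t) (left t + s) f x else 0) *
  (if e == tag t' then ext (left t') (left t' + s) g x else 0) = 0 :> R.
Proof.
case: t t' => [e1 j1] [e2 j2] tt'; rewrite /left/=.
case: eqP => [E1|_]; last by rewrite mul0r.
case: eqP => [E2|_]; last by rewrite mulr0.
subst e e2; have jj : (j1 : nat) != j2.
  by apply: contraNneq tt' => jj; apply/eqP; congr existT; exact: val_inj.
have S (i j : nat) : (i < j)%N -> i%:R * s + s <= j%:R * s.
  by move=> ij; rewrite -[X in _ + X]mul1r -mulrDl natr1 ler_wpM2r ?ler_nat// ltW.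
move: jj; rewrite neq_ltn => /orP[] /S h; first exact: ext_disj.
by rewrite mulrC; exact: ext_disj.
Qed.

Lemma bump_form_orthogonal t t' : t != t' -> formV (bump t) (bump t') = 0.
Proof.
move=> tt'; rewrite /formV /formR big1 ?add0r => [|e _].
  by rewrite /vertR big1// => i _; rewrite big1// => j _; rewrite !bump_endv mulr0.
rewrite -[RHS](Int0 0 (ell e)); apply: eq_Int => x _.
by rewrite -mulrA !disj// mulr0 addr0.
Qed.

Lemma bump_dot_orthogonal t t' : t != t' -> dotV (bump t) (bump t') = 0.
Proof.
move=> tt'; rewrite /dotV /dotR big1// => e _.
by rewrite -[RHS](Int0 0 (ell e)); apply: eq_Int => x _; rewrite disj.
Qed.

Lemma bump_dot t : dotV (bump t) (bump t) = s / 2.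
Proof.
rewrite /dotV /dotR (bigD1 (tag t))//= big1 ?addr0 => [|e /negbTE et]; last first.
  by rewrite et -[RHS](Int0 0 (ell e)); apply: eq_Int => x _; rewrite mulr0.
rewrite eqxx -(Int_sin2 (left t) s0) -(@Int_ext _ (left t) (left t + s) (ell (tag t)))//.
  by apply: eq_Int => x _; rewrite /ext; case: ifP; rewrite ?mulr0.
by case: (h1_sqi (h1_sin (left t) (left t + s) k (left t))).
Qed.

Lemma bump_form t Q : (forall e, Int 0 (ell e) (fun x => `|q e x|) <= Q) ->
  formV (bump t) (bump t) <= k ^+ 2 * (s / 2) + Q.
Proof.
move=> qQ; rewrite /formV /formR [X in _ + X]/vertR [X in _ + X]big1 ?addr0; last first.
  by move=> i _; rewrite big1// => j _; rewrite !bump_endv mulr0.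
rewrite (bigD1 (tag t))//= big1 ?addr0 => [|e /negbTE et]; last first.
  by rewrite et -[RHS](Int0 0 (ell e)); apply: eq_Int => x _; rewrite !mulr0 addr0.
rewrite eqxx; set e := tag t; set a := left t.
have [a0 aas asl] : [/\ 0 <= a, a <= a + s & a + s <= ell e].
  by split; [exact: left_ge0|exact: left_le|exact: left_ell].
have iq : integ a (a + s) (q e).
  exact: (integS (q_integ e) (left_ge0 t) (left_ell t)).
have [hs hc] := (h1_sin a (a + s) k a, (h1_sin a (a + s) k a).2).
have iqs : integ a (a + s) (fun x => q e x * sin (k * (x - a)) ^+ 2).
  have cs := h1_cont hs.
  by apply: eq_integ (integM_cont cs (integM_cont cs iq)) => x _ /=; ring.
rewrite (@eq_Int _ _ _ _ (ext a (a + s) (fun x =>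
    (k * cos (k * (x - a))) ^+ 2 + q e x * sin (k * (x - a)) ^+ 2))); last first.
  by move=> x _; rewrite /ext; case: ifP => _; rewrite ?mulr0 ?addr0//; ring.
rewrite Int_ext//; last by apply: integD => //; case: hc.
rewrite IntD//; last by case: hc.
rewrite -(Int_cos2 a s0); apply: lerD => //.
apply: le_trans (Int_q_sin2 k iq) _; apply: le_trans (qQ e).
have inq := integ_norm (q_integ e).
have al : a <= ell e by apply: le_trans (left_ell t); exact: left_le.
rewrite (@Int_cat _ 0 (ell e) a)// (@Int_cat _ a (ell e) (a + s))//; last first.
  exact: (integS inq).
have P x y : 0 <= Int x y (fun x => `|q e x|) by exact: Int_ge0.
by rewrite addrCA lerDl addr_ge0.
Qed.

End bumps.

(** More than [n] arches leave room for a nonzero combination orthogonal to the first [n]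
    eigenfunctions. An arch has squared norm [s / 2], whence a potential energy of at most [Q] per
    arch contributes [2 * Q / s] to the Rayleigh quotient. *)
Lemma weyl_upper n s Q : 0 < s ->
  (forall e, Int 0 (ell e) (fun x => `|q e x|) <= Q) ->
  (n < \sum_(e : edge G) Num.trunc (ell e / s))%N ->
  lambda n <= (pi / s) ^+ 2 + 2 * Q / s.
Proof.
move=> s0 qQ cnt; pose T := {e : edge G & 'I_(Num.trunc (ell e / s))}.
have cT : (#|{: 'I_n}| < #|{: T}|)%N.
  rewrite card_ord; apply: leq_trans cnt _.
  rewrite card_tagged sumnE big_map big_enum/= leq_eqVlt; apply/orP; left.
  by apply/eqP; apply: eq_bigr => e _; rewrite card_ord.
have [c [[t0 ct0] cz]] :=
  exists_kernel (fun (t : T) (i : 'I_n) => dotV (bump t) (Psi i)) cT.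
have Db (t : T) : dom (bump t) by exact: bump_dom.
pose f : V := \sum_t c t *: bump t.
have Df : dom f by exact: (dom_sum (dom0 w V0) (@domD _ _ w V0)).
have dE : dotV f f = \sum_t c t ^+ 2 * (s / 2).
  rewrite /f (form_sum_orthogonal (dom0 w V0) (@domD _ _ w V0)
    (fun u v _ _ => dotVC u v) (@dotVD _ _ w V0) c Db); last exact: bump_dot_orthogonal.
  by apply: eq_bigr => t _; rewrite bump_dot.
have d0 : 0 < dotV f f.
  rewrite dE (bigD1 t0)//= ltr_wpDr//.
    by apply: sumr_ge0 => j _; rewrite mulr_ge0 ?sqr_ge0// ltW// divr_gt0.
  by rewrite mulr_gt0 ?exprn_even_gt0// divr_gt0.
rewrite -(ler_pM2r d0).
have [C lb] := @formV_lower_bound _ _ q B w V0 q_integ q_ge0.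
apply: (@le_trans _ _ (formV f f)).
  apply: (rayleigh_ge (dom0 w V0) (@domD _ _ w V0) (fun u v _ _ => formVC q B_hermitian u v)
   (formVD B q_integ) (fun u v _ _ => dotVC u v) (@dotVD _ _ w V0)
   lambda_homo Psi_dom Psi_eigen Psi_orthonormal Df _ lb).
    move=> k kn; rewrite /f (form_suml (dom0 w V0) (@domD _ _ w V0) (@dotVD _ _ w V0))//.
      exact: (cz (Ordinal kn)).
    exact: Psi_dom.
  exact: Psi_complete.
rewrite /f (form_sum_orthogonal (dom0 w V0) (@domD _ _ w V0)
  (fun u v _ _ => formVC q B_hermitian u v) (formVD B q_integ) c Db); last first.
  exact: bump_form_orthogonal.
rewrite -/f dE mulr_sumr; apply: ler_sum => t _.
rewrite mulrCA ler_wpM2l ?sqr_ge0//; apply: le_trans (bump_form s0 t qQ) _.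
rewrite le_eqVlt; apply/orP; left; apply/eqP; field.
by rewrite gt_eqF.
Qed.

End eigenbasis.

(** * Zeros of eigenfunctions on an edge *)

Section eigenfunction_on_edge.
Context {R : realType} (G : metric_graph R).
Variables (q : edge G -> R -> R) (B : 'M[R[i]]_#|{: edge G * bool}|).
Variables (w : edge G * bool -> R) (V0 : {set vertex G}).
Hypothesis q_integ : forall e, integ 0 (ell e) (q e).
Hypothesis q_ge0 : forall e,
  {ae lebesgue_measure, forall x, 0 <= x <= ell e -> 0 <= q e x}.
Variables (lambda : nat -> R) (psi : nat -> edge G -> R -> R).
Hypothesis psi_basis : ordered_real_eigenbasis q B w V0 lambda psi.
Variables (n : nat) (e : edge G).

Let f := (Psi psi n).1 e : R -> R.
Let g := (Psi psi n).2 e : R -> R.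

Lemma psi_h1 : h1 0 (ell e) f g.
Proof. exact: dom_h1 e (Psi_dom psi_basis n). Qed.

Lemma psi_cont : {within `[0, ell e], continuous (psi n e)}.
Proof. exact: h1_cont psi_h1. Qed.

(** Extended by zero, [p] vanishes at every edge end; hence it is admissible, and neither the vertex
    form nor the other edges contribute. What remains is the weak Sturm-Liouville equation on
    [[a, b]]. *)
Lemma edge_weak a b p r : 0 <= a -> a <= b -> b <= ell e -> h1 a b p r ->
  p a = 0 -> p b = 0 ->
  Int a b (fun t => g t * r t + q e t * f t * p t) =
  lambda n * Int a b (fun t => f t * p t).
Proof.
move=> a0 ab bl pr pa pb.
pose v : (edge G -> R -> R^o) * (edge G -> R -> R^o) :=
  (fun e' x => if e' == e then ext a b p x else 0,
   fun e' x => if e' == e then ext a b r x else 0).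
have vend i : endv v.1 i = 0.
  case: i => e' c; rewrite /endv /end_coord/=; case: eqP => [->|//]; case: c => /=.
    by rewrite /ext ltNge bl andbF.
  rewrite /ext; case: ifP => // /andP[a0' _].
  have a00 : a = 0 by apply/le_anti; rewrite a0' a0.
  by rewrite -[X in p X]a00.
have Dv : dom w V0 v.
  apply: dom_vanish => // e'; rewrite /v/=.
  have [->|_] := eqVneq e' e; last exact: h1_cst.
  exact: h1_ext.
have [_ sg] := psi_h1; have sf := h1_sqi psi_h1; have [_ sr] := pr.
have iq : integ a b (q e) by exact: (integS (q_integ e)).
have fab : {within `[a, b], continuous f} by exact: h1_cont (h1S psi_h1 a0 bl).
have i1 : integ a b (fun t => g t * r t + q e t * f t * p t).
  apply: integD; first by apply: sqiM => //; exact: (sqiS sg).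
  apply: eq_integ (integM_cont fab (integM_cont (h1_cont pr) iq)) => t _.
  by ring.
have i2 : integ a b (fun t => f t * p t).
  by apply: sqiM; [exact: (sqiS sf)|exact: h1_sqi pr].
have := Psi_eigen q_integ psi_basis n Dv.
rewrite /formV /formR [X in _ + X = _]/vertR [X in _ + X = _]big1 ?addr0; last first.
  by move=> i _; rewrite big1// => j _; rewrite vend mulr0.
rewrite (bigD1 e)//= big1 ?addr0 => [|e' /negbTE ee]; last first.
  by rewrite ee -[RHS](Int0 0 (ell e')); apply: eq_Int => x _; rewrite !mulr0 addr0.
rewrite eqxx /dotV /dotR (bigD1 e)//= big1 ?addr0 => [|e' /negbTE ee]; last first.
  by rewrite ee -[RHS](Int0 0 (ell e')); apply: eq_Int => x _; rewrite mulr0.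
rewrite eqxx => E.
rewrite -(Int_ext a0 ab bl i1) -(Int_ext a0 ab bl i2) -/f -/g.
transitivity (Int 0 (ell e) (fun x => g x * ext a b r x + q e x * f x * ext a b p x)).
  by apply: eq_Int => x _; rewrite /ext; case: ifP; rewrite ?mulr0 ?addr0.
rewrite [LHS]E; congr (_ * _).
by apply: eq_Int => x _; rewrite Mext.
Qed.

(** Between two of its zeros the eigenfunction is its own test function. The point [z] excludes an
    interval on which it vanishes identically. *)
Lemma edge_gap x y : 0 <= x -> x < y -> y <= ell e -> psi n e x = 0 ->
  psi n e y = 0 -> (exists2 z, x < z < y & psi n e z != 0) ->
  (pi / (y - x)) ^+ 2 <= lambda n.
Proof.
move=> x0 xy yl fx fy [z xzy fz].
have hf : h1 x y f g by exact: h1S psi_h1 x0 yl.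
apply: (gap (q := q e) xy hf fx fy).
- exact: (integS (q_integ e)).
- apply: (@filterS _ _ (ae_filter_ringOfSetsType lebesgue_measure)) (q_ge0 e).
  by move=> t qt /andP[xt ty]; apply: qt; rewrite (le_trans x0)//= (le_trans ty).
- exact: edge_weak x0 (ltW xy) yl hf fx fy.
- apply: (Int_gt0 xzy); first exact: h1_cont (h1M hf hf).
    by move=> t _; rewrite -expr2 sqr_ge0.
  by rewrite -expr2 exprn_even_gt0.
Qed.

(** Meant to be read in contrapositive form: once [lambda n] exceeds the right-hand side, every
    interval of length [d] in the edge contains a zero. Bounding [q] over the whole edge makes this
    uniform in [x]. *)
Lemma edge_zero x d Q : 0 <= x -> 0 < d -> x + d <= ell e ->
  Int 0 (ell e) (fun t => `|q e t|) <= Q ->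
  (forall t, x <= t <= x + d -> psi n e t != 0) ->
  lambda n <= (pi / d) ^+ 2 + 2 * Q / d.
Proof.
move=> x0 d0 xdl qQ f0; have xd : x <= x + d by rewrite lerDl ltW.
have hf : h1 x (x + d) f g by exact: h1S psi_h1 x0 xdl.
have iq : integ x (x + d) (q e) by exact: (integS (q_integ e)).
have := @picone _ x d f g (q e) (lambda n) d0 hf iq f0.
move=> H; apply: le_trans (H _) _.
  by move=> p r pr px py; exact: edge_weak x0 xd xdl pr px py.
rewrite lerD2l ler_pM2r ?invr_gt0// ler_pM2l//; apply: le_trans qQ.
have inq := integ_norm (q_integ e).
have xl : x <= ell e by exact: le_trans xd xdl.
rewrite (@Int_cat _ 0 (ell e) x)// (@Int_cat _ x (ell e) (x + d))//; last first.
  exact: (integS inq).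
have P a b : 0 <= Int a b (fun x => `|q e x|) by exact: Int_ge0.
by rewrite addrCA lerDl addr_ge0.
Qed.

End eigenfunction_on_edge.

Lemma lee_size_sum (R : realType) (T : eqType) (s : seq T) (F : T -> \bar R) (c : R) :
  (forall x, x \in s -> c%:E <= F x)%E ->
  (((size s)%:R * c)%:E <= \sum_(x <- s) F x)%E.
Proof.
elim: s => [|x s IH] H; first by rewrite big_nil mul0r.
rewrite big_cons/= -natr1 mulrDl mul1r addrC EFinD leeD//.
  by apply: H; rewrite mem_head.
by apply: IH => y ys; apply: H; rewrite in_cons ys orbT.
Qed.

Lemma lee_sum_size (R : realType) (T : eqType) (s : seq T) (F : T -> \bar R) (c : R) :
  (forall x, x \in s -> F x <= c%:E)%E ->
  (\sum_(x <- s) F x <= ((size s)%:R * c)%:E)%E.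
Proof.
elim: s => [|x s IH] H; first by rewrite big_nil mul0r.
rewrite big_cons/= -natr1 mulrDl mul1r addrC EFinD leeD//.
  by apply: IH => y ys; apply: H; rewrite in_cons ys orbT.
by apply: H; rewrite mem_head.
Qed.

(** * Components of the nonzero set on one edge *)

Section components_on_interval.
Context {R : realType} (l m d : R) (f : R -> R).
Implicit Types x y z t : R.
Hypotheses (l0 : 0 <= l) (m0 : 0 < m) (d0 : 0 < d).
Hypothesis f_cont : {within `[0, l], continuous f}.
Hypothesis f_gap : forall x y, 0 <= x -> x < y -> y <= l -> f x = 0 -> f y = 0 ->
  (exists2 z, x < z < y & f z != 0) -> m <= y - x.
Hypothesis f_zero : forall x, 0 <= x -> x + d <= l ->
  exists2 t, x <= t <= x + d & f t = 0.

Definition nz : set R := [set x | 0 <= x <= l /\ f x != 0].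

(** The component of [z] in [nz], described by the order of the line alone: no zero lies between [z]
    and [y]. *)
Definition cls z : set R := [set y | 0 <= y <= l /\
  forall t, z <= t <= y \/ y <= t <= z -> f t != 0].

Lemma cls_refl z : nz z -> cls z z.
Proof.
move=> [zl fz]; split=> // t zt; rewrite (_ : t = z)//.
by apply/le_anti; case: zt => /andP[-> ->].
Qed.

Lemma cls_nz z y : cls z y -> nz y.
Proof.
move=> [yl H]; split=> //.
by have [h|/ltW h] := leP z y; apply: H; [left|right]; rewrite h lexx.
Qed.

Lemma cls_sym z y : nz z -> cls z y -> cls y z.
Proof. by move=> [zl _] [yl H]; split=> // t [h|h]; apply: H; [right|left]. Qed.

Lemma cls_trans x y z : cls x y -> cls y z -> cls x z.
Proof.
move=> [yl H1] [zl H2]; split=> // t [] /andP[h1 h2].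
  have [ty|yt] := leP t y; [apply: H1|apply: H2]; left; first by rewrite h1.
  by rewrite (ltW yt).
have [ty|yt] := leP t y; [apply: H2|apply: H1]; right; first by rewrite h1.
by rewrite (ltW yt).
Qed.

Lemma cls_eq z y : nz z -> cls z y -> cls y = cls z.
Proof.
move=> nz_z zy; apply/seteqP; split => x; first exact: cls_trans zy.
exact: cls_trans (cls_sym nz_z zy).
Qed.

Lemma cls_interval z : is_interval (cls z).
Proof.
move=> x y [/andP[x0 xl] Hx] [/andP[y0 yl] Hy] t /andP[xt ty].
split; first by rewrite (le_trans x0 xt) (le_trans ty yl).
move=> s [/andP[s1 s2]|/andP[s1 s2]].
  by apply: Hy; left; rewrite s1 (le_trans s2).
by apply: Hx; right; rewrite s2 (le_trans xt).
Qed.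

Lemma cls_measurable z : measurable (cls z).
Proof. exact: is_interval_measurable (@cls_interval z). Qed.

Lemma cls_disj z y : nz z -> nz y -> cls z `&` cls y !=set0 -> cls z = cls y.
Proof. by move=> nz1 nz2 [x [zx yx]]; rewrite -(cls_eq nz1 zx) (cls_eq nz2 yx). Qed.

(** The zeros on both sides lie strictly inside the edge; a zero at an edge end does not count. The
    closure of the component then stays away from the vertices, and nothing can merge with it. *)
Definition inner z := [/\ nz z, exists2 t, 0 < t < z & f t = 0 &
  exists2 t, z < t < l & f t = 0].

(* The zero set is closed, so the nearest zeros on both sides exist. *)
Lemma inner_itv z : inner z -> exists x y, [/\ 0 < x, x < z, z < y & y < l] /\
  [/\ f x = 0, f y = 0 & cls z = `]x, y[%classic].
Proof.
move=> [[/andP[z0 zl] fz] [t1 /andP[t10 t1z] ft1] [t2 /andP[zt2 t2l] ft2]].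
have NV x : 0 <= x <= l -> f x != 0 ->
    exists2 r, 0 < r & forall t, 0 <= t <= l -> `|x - t| < r -> f t != 0.
  move=> xl fx; have : f @ within `[0, l] (nbhs x) --> f x.
    by move/subspace_continuousP: f_cont; apply; rewrite /= in_itv.
  move/cvgrPdist_lt => /(_ `|f x|); rewrite normr_gt0 => /(_ fx).
  rewrite near_withinE => -[/= r r0 Hr]; exists r => // t tl xt.
  have := Hr t xt; rewrite /= in_itv/= => /(_ tl).
  by apply: contraTneq => ->; rewrite subr0 ltxx.
pose S1 := [set t | t1 <= t <= z /\ f t = 0].
pose S2 := [set t | z <= t <= t2 /\ f t = 0].
have S1t : S1 t1 by split=> //; rewrite lexx ltW.
have S2t : S2 t2 by split=> //; rewrite lexx ltW.
have hS1 : has_sup S1.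
  by split; [exists t1|exists z => t [/andP[]]].
have hS2 : has_inf S2.
  by split; [exists t2|exists z => t [/andP[]]].
have x1 : t1 <= sup S1 by exact: (sup_upper_bound hS1).
have x2 : sup S1 <= z by apply: sup_le_ub => [|t [/andP[]]//]; exists t1.
have y1 : inf S2 <= t2 by exact: (ge_inf hS2.2).
have y2 : z <= inf S2 by apply: lb_le_inf => [|t [/andP[]]//]; exists t2.
have fx : f (sup S1) = 0.
  apply/eqP/negPn/negP => fx0; have [||r r0 Hr] := NV (sup S1); [lra|by []|].
  have [t [/andP[t1t tz] ft] xt] := sup_adherent r0 hS1.
  have tx : t <= sup S1 by apply: (sup_upper_bound hS1); split=> //; rewrite t1t.
  have := Hr t; rewrite ft eqxx => H; suff: false by [].
  by apply: H; [lra|rewrite ger0_norm; lra].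
have fy : f (inf S2) = 0.
  apply/eqP/negPn/negP => fy0; have [||r r0 Hr] := NV (inf S2); [lra|by []|].
  have [t [/andP[zt tt2] ft] ty] := inf_adherent r0 hS2.
  have yt : inf S2 <= t by apply: (ge_inf hS2.2); split=> //; rewrite zt.
  have := Hr t; rewrite ft eqxx => H; suff: false by [].
  by apply: H; [lra|rewrite distrC ger0_norm; lra].
have xz : sup S1 < z by rewrite lt_neqAle x2 andbT; apply: contraNneq fz => <-; apply/eqP.
have zy : z < inf S2 by rewrite lt_neqAle y2 andbT; apply: contraNneq fz => ->; apply/eqP.
exists (sup S1), (inf S2); split; first by split=> //; lra.
split=> //; apply/seteqP; split=> u /=; rewrite in_itv/=.
  move=> [ul H]; apply/andP; split.
    rewrite ltNge; apply/negP => ux; have := H (sup S1); rewrite fx eqxx => K.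
    by suff: false by []; apply: K; right; rewrite ux ltW.
  rewrite ltNge; apply/negP => yu; have := H (inf S2); rewrite fy eqxx => K.
  by suff: false by []; apply: K; left; rewrite yu ltW.
move=> /andP[xu uy]; split; first by lra.
move=> t [] /andP[h1 h2]; apply/eqP => ft.
  have : inf S2 <= t by apply: (ge_inf hS2.2); split=> //; lra.
  lra.
have : t <= sup S1 by apply: (sup_upper_bound hS1); split=> //; lra.
lra.
Qed.

(** Two points of a component that are more than [d] apart would enclose a zero. *)
Lemma cls_le z : nz z -> (lebesgue_measure (cls z) <= d%:E)%E.
Proof.
move=> nzz; have Cz := cls_refl nzz.
have P x y : cls z x -> cls z y -> y <= x + d.
  move=> zx zy; rewrite leNgt; apply/negP => xdy.
  have [/andP[x0 xl] _] := cls_nz zx; have [/andP[y0 yl] _] := cls_nz zy.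
  have [t /andP[xt td] ft] : exists2 t, x <= t <= x + d & f t = 0.
    by apply: f_zero => //; lra.
  have : cls z t by apply: (cls_interval zx zy); lra.
  by move=> /cls_nz [_]; rewrite ft eqxx.
have hC : has_inf (cls z).
  by split; [exists z|exists 0 => t [/andP[]]].
apply: (@le_trans _ _ (lebesgue_measure `[inf (cls z), inf (cls z) + d]%classic)).
  apply: le_measure; rewrite ?inE//; first exact: cls_measurable.
  move=> y zy; rewrite /= in_itv/= (ge_inf hC.2)//=.
  by rewrite -lerBlDr; apply: lb_le_inf; [exists z|move=> x zx; have := P _ _ zx zy; lra].
rewrite lebesgue_measure_itv/= lte_fin; case: ifP => _.
  by rewrite -EFinB lee_fin; lra.
by rewrite lee_fin ltW.
Qed.

Lemma cls_ge z : inner z -> (m%:E <= lebesgue_measure (cls z))%E.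
Proof.
move=> iz; have [x [y [[x0 xz zy yl] [fx fy ->]]]] := inner_itv iz.
have xy : x < y by exact: lt_trans zy.
rewrite lebesgue_measure_itv/= lte_fin xy -EFinB lee_fin.
apply: f_gap; [exact: ltW|by []|exact: ltW|by []|by []|].
by exists z; [rewrite xz|case: iz => -[]].
Qed.

Definition classes := cls @` nz.
Definition inner_classes := cls @` inner.

Lemma inner_classes_sub : inner_classes `<=` classes.
Proof. by move=> _ [z [nzz _ _] <-]; exists z. Qed.

Lemma classes_trivIset : trivIset classes id.
Proof. by move=> _ _ [z nzz <-] [y nzy <-]; exact: cls_disj. Qed.

Lemma classes_measurable (C : set R) : classes C -> measurable C.
Proof. by move=> [z _ <-]; exact: cls_measurable. Qed.

Lemma bigcup_classes : \bigcup_(C in classes) C = nz.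
Proof.
apply/seteqP; split => [x [_ [z nzz <-]]|x nzx]; first exact: cls_nz.
by exists (cls x); [exists x|exact: cls_refl].
Qed.

(** Disjoint sets of measure at least [m] are packed into [[0, l]]. The bound concerns arbitrary
    finite families because finiteness of [inner_classes] is deduced from it. *)
Lemma inner_classes_mass (F : {fset set R}) : [set` F] `<=` inner_classes ->
  ((#|` F|)%:R * m <= l).
Proof.
move=> FI; rewrite -lee_fin.
have FC : [set` F] `<=` classes by apply: subset_trans inner_classes_sub.
apply: (@le_trans _ _ (lebesgue_measure (\bigcup_(C in [set` F]) C))); last first.
  apply: (@le_trans _ _ (lebesgue_measure `[0, l]%classic)).
    apply: le_measure; rewrite ?inE//.
      apply: fin_bigcup_measurable => // C /FC; exact: classes_measurable.
    by move=> x [C /FC [z nzz <-] /cls_nz [xl _]]; rewrite /= in_itv.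
  rewrite lebesgue_measure_itv/= lte_fin; case: ifP => _; last by rewrite lee_fin.
  by rewrite -EFinB lee_fin subr0.
rewrite measure_fin_bigcup//; last 2 first.
- exact: sub_trivIset FC classes_trivIset.
- by move=> C /FC; exact: classes_measurable.
rewrite fsbig_finite//= set_fsetK.
apply: lee_size_sum => C CF; have [z iz <-] := FI C CF.
exact: cls_ge.
Qed.

Lemma inner_classes_finite : finite_set inner_classes.
Proof.
apply: contrapT => /(infinite_set_fset (Num.trunc (l / m)).+1) [F FI cF].
have := inner_classes_mass FI; rewrite -ler_pdivlMr// leNgt => /negP; apply.
by apply: lt_le_trans (truncnS_gt _) _; rewrite ler_nat.
Qed.

(** A component that is not inner lacks an interior zero on the left or on the right. All points
    without one on the left are in a single component, and likewise on the right. *)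
Lemma classes_cover : exists C1 C2 : set R,
  classes `<=` inner_classes `|` [set C1; C2].
Proof.
pose A := [set z | nz z /\ forall t, 0 < t < z -> f t != 0].
pose B := [set z | nz z /\ forall t, z < t < l -> f t != 0].
have HA x y : A x -> A y -> x <= y -> cls x = cls y.
  move=> [nx _] [ny Hy] xy; apply/esym/cls_eq => //; split; first by case: ny.
  have [/andP[x0 _] fx] := nx; have [_ fy] := ny.
  move=> t []; last by move=> h; have -> : t = x by lra.
  rewrite le_eqVlt => /andP[/predU1P[<-//|xt]].
  by rewrite le_eqVlt => /predU1P[->//|ty]; apply: Hy; lra.
have HB x y : B x -> B y -> x <= y -> cls x = cls y.
  move=> [nx Hx] [ny _] xy; apply/esym/cls_eq => //; split; first by case: ny.
  have [_ fx] := nx; have [/andP[_ yl] fy] := ny.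
  move=> t []; last by move=> h; have -> : t = x by lra.
  rewrite le_eqVlt => /andP[/predU1P[<-//|xt]].
  by rewrite le_eqVlt => /predU1P[->//|ty]; apply: Hx; lra.
have EA x y : A x -> A y -> cls x = cls y.
  by move=> Ax Ay; have [xy|/ltW yx] := leP x y; [|apply/esym]; exact: HA.
have EB x y : B x -> B y -> cls x = cls y.
  by move=> Ax Ay; have [xy|/ltW yx] := leP x y; [|apply/esym]; exact: HB.
(* If [A] or [B] is empty, the default point 0 yields some irrelevant set, harmless in a
   covering. *)
exists (cls (xget 0 A)), (cls (xget 0 B)) => _ [z nzz <-].
have [Az|Az] := pselect (A z).
  by right; left; apply: EA => //; exact: (xgetPex _ (ex_intro _ z Az)).
have [Bz|Bz] := pselect (B z).
  by right; right; apply: EB => //; exact: (xgetPex _ (ex_intro _ z Bz)).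
left; exists z => //; split => //; apply: contrapT => H.
  apply: Az; split=> // t tz; apply/negP => /eqP ft; apply: H; by exists t.
by apply: Bz; split=> // t tz; apply/negP => /eqP ft; apply: H; exists t.
Qed.

Lemma classes_finite : finite_set classes.
Proof.
have [C1 [C2 H]] := classes_cover; apply: sub_finite_set H _.
by rewrite finite_setU; split; [exact: inner_classes_finite|exact: finite_set2].
Qed.

Lemma card_classes : (#|` fset_set classes| <= #|` fset_set inner_classes| + 2)%N.
Proof.
have [C1 [C2 H]] := classes_cover; have fI := inner_classes_finite.
apply: (@leq_trans #|` fset_set (inner_classes `|` [set C1; C2])|).
  apply: fsubset_leq_card; rewrite -fset_set_sub//; last first.
    by rewrite finite_setU; split=> //; exact: finite_set2.
  exact: classes_finite.
rewrite fset_setU// cardfsU; apply: leq_trans (leq_subr _ _) _; rewrite leq_add2l.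
by rewrite fset_setU// !fset_set1 cardfs2; case: eqP.
Qed.

Lemma nz_measurable : measurable nz.
Proof.
rewrite -bigcup_classes; apply: fin_bigcup_measurable; first exact: classes_finite.
by move=> C; exact: classes_measurable.
Qed.

Lemma measure_nz : lebesgue_measure nz =
  (\sum_(C <- fset_set classes) lebesgue_measure C)%E.
Proof.
rewrite -bigcup_classes measure_fin_bigcup//; last 3 first.
- exact: classes_finite.
- exact: classes_trivIset.
- exact: classes_measurable.
by rewrite fsbig_finite//; exact: classes_finite.
Qed.

Lemma measure_nz_bounds :
  (((#|` fset_set inner_classes|)%:R * m)%:E <= lebesgue_measure nz
    <= ((#|` fset_set classes|)%:R * d)%:E)%E.
Proof.
rewrite measure_nz; apply/andP; split; last first.
  apply: lee_sum_size => C; rewrite in_fset_set; last exact: classes_finite.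
  by rewrite inE => -[z nzz <-]; exact: cls_le.
have IC := inner_classes_sub; have fC := classes_finite.
have fI := inner_classes_finite.
apply: (@le_trans _ _ (\sum_(C <- fset_set inner_classes) lebesgue_measure C)%E).
  apply: lee_size_sum => C; rewrite in_fset_set//.
  by rewrite inE => -[z iz <-]; exact: cls_ge.
rewrite -!fsbig_finite//; apply: lee_fsum_nneg_subset => //.
by move=> C; rewrite !inE => /IC.
Qed.

End components_on_interval.

(** * Nodal domains *)

Section graph_topology.
Context {R : realType} (G : metric_graph R).
Local Open Scope quotient_scope.
Implicit Types (e : edge G) (x y z : R).

Let ell0 e : 0 <= ell e.
Proof. exact: ltW (ell_gt0 e). Qed.

Lemma graph_point_eq (x y : edge_union G) :
  graph_point x = graph_point y <-> glue_class x = glue_class y.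
Proof.
split=> [/eqmodP/eqP//|xy].
by apply/eqmodP; rewrite /= /glue_rel xy.
Qed.

Let clampP e x : edge_interval e (Num.max 0 (Num.min x (ell e))).
Proof. by rewrite /edge_interval/= in_itv/= le_max lexx/= ge_max ell0 ge_min lexx orbT. Qed.

(** Projecting the line onto the edge makes [gpt e] a continuous map on all of [R], so that subsets
    of the line can be pushed into the graph directly. *)
Definition clamp e x : set_type (edge_interval e) :=
  exist _ (Num.max 0 (Num.min x (ell e))) (mem_set (clampP e x)).

Lemma clampK e x : 0 <= x <= ell e -> set_val (clamp e x) = x.
Proof.
by move=> /andP[x0 xl]; rewrite set_valE/= min_l// max_r.
Qed.

Definition gpt e x : graph_space G := graph_point (existT _ e (clamp e x)).

Lemma set_val_itv e (z : set_type (edge_interval e)) : 0 <= set_val z <= ell e.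
Proof.
by case: z => z zP; have := set_mem zP; rewrite set_valE /edge_interval/= in_itv.
Qed.

Lemma graph_pointE e (z : set_type (edge_interval e)) :
  graph_point (existT _ e z) = gpt e (set_val z).
Proof.
congr (graph_point (existT _ e _)); apply: val_inj.
by have := clampK (set_val_itv z); rewrite !set_valE => /esym.
Qed.

(** An interior point of an edge is alone in its gluing class. *)
Lemma gpt_inj e e' x x' : 0 < x < ell e -> 0 <= x' <= ell e' ->
  gpt e x = gpt e' x' -> e = e' /\ x = x'.
Proof.
move=> /andP[x0 xl] xl' /graph_point_eq.
have xle : 0 <= x <= ell e by rewrite !ltW.
rewrite {1}/glue_class /end_coord/= clampK// gt_eqF// lt_eqF//.
rewrite /glue_class/=; case: ifP => // _; case: ifP => // _ E.
have := congr1 (fun s : vertex G + edge_union G =>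
  if s is inr u then (projT1 u, set_val (projT2 u)) else (e, 0)) E.
by rewrite /= !clampK// => -[-> ->].
Qed.

Lemma clamp_continuous e : continuous (clamp e).
Proof.
apply: (@continuous_comp_initial _ _ _ (@set_val _ (edge_interval e))).
have -> : set_val \o clamp e = (fun x => Num.max 0 (Num.min x (ell e))).
  by apply/funext => x; rewrite /= set_valE.
move=> x; apply: (@continuous_max _ _ (cst 0) (fun x => Num.min x (ell e))).
  exact: cvg_cst.
by apply: (@continuous_min _ _ id (cst (ell e))) => //; exact: cvg_cst.
Qed.

Lemma gpt_continuous e : continuous (gpt e).
Proof.
have -> : gpt e = @graph_point _ G \o
  (existT (fun e => set_type (edge_interval e)) e \o clamp e) by [].
move=> x; apply: continuous_comp.
  by apply: continuous_comp; [exact: clamp_continuous|exact: existT_continuous].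
exact: (@pi_continuous (edge_union G) (graph_space G)).
Qed.

(** As interior points are not glued, the image of [S] pulls back to [S] on its own edge and to
    nothing on the others. Openness and closedness in the quotient can thus be checked edge by
    edge. *)
Lemma gpt_preimage e e' (S : set R) : S `<=` `]0, ell e[%classic ->
  existT (fun e => set_type (edge_interval e)) e' @^-1` (@graph_point _ G @^-1` (gpt e @` S)) =
  if e' == e then @set_val _ (edge_interval e') @^-1` S else set0.
Proof.
move=> Se; apply/seteqP; split => z /=.
  move=> [x Sx]; rewrite graph_pointE => H.
  have x0 : 0 < x < ell e by have := Se _ Sx; rewrite /= in_itv.
  have [E xz] := gpt_inj x0 (set_val_itv z) H.
  by have -> : e' == e by [apply/eqP]; rewrite /= -xz.
case: eqP => [E|//] Sz; exists (set_val z) => //; rewrite graph_pointE.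
by move: (set_val z) => s; rewrite E.
Qed.

Let set_val_continuous e : continuous (@set_val _ (edge_interval e)).
Proof. exact: initial_continuous. Qed.

Lemma gpt_open e (S : set R) : open S -> S `<=` `]0, ell e[%classic ->
  open (gpt e @` S).
Proof.
move=> oS Se; suff : open (@graph_point _ G @^-1` (gpt e @` S)) by [].
apply/sigT_openP => e'; rewrite gpt_preimage//.
case: ifP => _; last exact: open0.
by apply: open_comp => // z _; exact: set_val_continuous.
Qed.

Lemma gpt_closed e (S : set R) : closed S -> S `<=` `]0, ell e[%classic ->
  closed (gpt e @` S).
Proof.
move=> cS Se; rewrite -openC.
suff : open (@graph_point _ G @^-1` (~` (gpt e @` S))) by [].
apply/sigT_openP => e'.
suff : open (~` (existT (fun e => set_type (edge_interval e)) e' @^-1`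
                 (@graph_point _ G @^-1` (gpt e @` S)))) by [].
rewrite openC gpt_preimage//; case: ifP => _; last exact: closed0.
by apply: preimage_closed => // z _; exact: set_val_continuous.
Qed.

Section nodal.
Variable psi : edge G -> R -> R.
Local Notation NZ := (@nonzero_set R G psi).
Local Notation nz e := (nz (ell e) (psi e)).
Local Notation cls e := (cls (ell e) (psi e)).
Local Notation inner e := (inner (ell e) (psi e)).

Lemma nonzero_gpt e x : nz e x -> NZ (gpt e x).
Proof. by move=> [xl fx]; exists (existT _ e (clamp e x)) => //=; rewrite clampK. Qed.

Lemma nonzeroP p : NZ p <-> exists e x, nz e x /\ p = gpt e x.
Proof.
split=> [[[e z] /= fz <-]|[e [x [nzx ->]]]]; last exact: nonzero_gpt.
by exists e, (set_val z); split; [split=> //; exact: set_val_itv|exact: graph_pointE].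
Qed.

Lemma nonzero_gptE e x : 0 < x < ell e -> NZ (gpt e x) <-> psi e x != 0.
Proof.
move=> x0; split=> [/nonzeroP [e' [x' [[xl' fx'] /(gpt_inj x0 xl')[E1 E2]]]]|fx].
  by rewrite E1 E2.
by apply: nonzero_gpt; split=> //; case/andP: x0 => *; rewrite !ltW.
Qed.

Definition nodal_domain e x : set (graph_space G) :=
  closure (connected_component NZ (gpt e x)).

Lemma nodal_domainsE :
  nodal_domains psi = [set C | exists e x, nz e x /\ C = nodal_domain e x].
Proof.
apply/seteqP; split => C /=.
  by move=> [p /nonzeroP[e [x [nzx ->]]] <-]; exists e, x.
by move=> [e [x [nzx ->]]]; exists (gpt e x) => //; exact: nonzero_gpt.
Qed.

(** The image of the interval [cls e x] is a connected part of the nonzero set, so an edgewise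
    component determines a nodal domain. *)
Lemma nodal_domain_cls e x y : nz e x -> cls e x y ->
  nodal_domain e x = nodal_domain e y.
Proof.
move=> nzx xy; congr closure; apply: same_connected_component.
exists (gpt e @` cls e x); last by exists y.
split; first by exists x => //; exact: cls_refl.
  by move=> _ [z xz <-]; apply: nonzero_gpt; exact: cls_nz xz.
apply: connected_continuous_connected.
  apply/connected_intervalP; exact: cls_interval.
by apply: continuous_subspaceT; exact: gpt_continuous.
Qed.

Hypothesis psi_cont : forall e, {within `[0, ell e], continuous (psi e)}.

(** The image of the open interval between the neighbouring zeros is open in the graph. Within the
    nonzero set it equals the image of the closed interval, which is closed; being open and closed
    in the component, it is all of it. *)
Lemma component_inner e z : inner e z ->
  connected_component NZ (gpt e z) `<=` gpt e @` cls e z.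
Proof.
move=> iz; have nzz : nz e z by case: iz.
have [x [y [[x0 xz zy yl] [fx fy cE]]]] := inner_itv (@psi_cont e) iz.
set A := connected_component _ _; set O := gpt e @` _.
have sub_o : `]x, y[%classic `<=` `]0, ell e[%classic.
  by move=> t /=; rewrite !in_itv/=; lra.
have sub_c : `[x, y]%classic `<=` `]0, ell e[%classic.
  by move=> t /=; rewrite !in_itv/=; lra.
have oO : open O by rewrite /O cE; apply: gpt_open => //; exact: interval_open.
have AE : A `&` O = A.
  apply: (@component_connected _ NZ (gpt e z)).
  - exists (gpt e z); split; last by exists z => //; exact: cls_refl.
    by apply: connected_component_refl; exact: nonzero_gpt.
  - by exists O.
  - exists (gpt e @` `[x, y]%classic).
      by apply: gpt_closed => //; exact: interval_closed.
    apply/seteqP; split => p [Ap]; rewrite /O cE.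
      by move=> [t tI tp]; split=> //; exists t => //; exact: subset_itv_oo_cc.
    move=> [t tI pE]; split=> //; exists t => //.
    have : NZ (gpt e t) by rewrite pE; exact: connected_component_sub Ap.
    rewrite nonzero_gptE; last by have := sub_c _ tI; rewrite /= in_itv.
    move: tI; rewrite /= !in_itv/= => /andP[].
    rewrite le_eqVlt => /predU1P[<-|xt]; first by rewrite fx eqxx.
    rewrite le_eqVlt => /predU1P[->|ty]; first by rewrite fy eqxx.
    by rewrite xt ty.
by rewrite -AE; exact: subIsetr.
Qed.

(** Taking closures does not identify inner components: the image of the second is an open
    neighbourhood of one of its points in the common closure, so it meets the first component
    itself. *)
Lemma nodal_domain_inj e1 e2 z1 z2 : inner e1 z1 -> inner e2 z2 ->
  nodal_domain e1 z1 = nodal_domain e2 z2 -> e1 = e2 /\ cls e1 z1 z2.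
Proof.
move=> i1 i2 E; have nz2 : nz e2 z2 by case: i2.
have [x [y [[x0 xz zy yl] [fx fy cE]]]] := inner_itv (@psi_cont e2) i2.
have sub_o : `]x, y[%classic `<=` `]0, ell e2[%classic.
  by move=> t /=; rewrite !in_itv/=; lra.
have : nodal_domain e1 z1 (gpt e2 z2).
  rewrite E; apply: subset_closure; apply: connected_component_refl.
  exact: nonzero_gpt.
move=> /(_ (gpt e2 @` cls e2 z2)) [].
  apply: open_nbhs_nbhs; split.
    by rewrite cE; apply: gpt_open => //; exact: interval_open.
  by exists z2 => //; exact: cls_refl.
move=> p [/(component_inner i1) [t1 c1 <-] [t2 c2]].
have t2I : 0 < t2 < ell e2 by have := sub_o t2; rewrite -cE /= in_itv/=; exact.
have [t1I _] := cls_nz c1.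
move=> /(gpt_inj t2I t1I) [E1 E2]; subst e2 t2; split=> //.
exact: cls_trans c1 (cls_sym nz2 c2).
Qed.

End nodal.
End graph_topology.

(** * The nodal count against the measure of the nonzero set *)

Section nodal_counting.
Context {R : realType} (G : metric_graph R) (psi : edge G -> R -> R) (m d : R).
Hypotheses (m0 : 0 < m) (d0 : 0 < d).
Hypothesis psi_cont : forall e, {within `[0, ell e], continuous (psi e)}.
Hypothesis psi_gap : forall e x y, 0 <= x -> x < y -> y <= ell e ->
  psi e x = 0 -> psi e y = 0 ->
  (exists2 z, x < z < y & psi e z != 0) -> m <= y - x.
Hypothesis psi_zero : forall e x, 0 <= x -> x + d <= ell e ->
  exists2 t, x <= t <= x + d & psi e t = 0.

Local Notation NZ := (@nonzero_set R G psi).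
Local Notation nz e := (nz (ell e) (psi e)).
Local Notation cls e := (cls (ell e) (psi e)).
Local Notation inner e := (inner (ell e) (psi e)).
Local Notation K e := (classes (ell e) (psi e)).
Local Notation I e := (inner_classes (ell e) (psi e)).

Let fK e : finite_set (K e).
Proof. exact: (classes_finite (ltW (ell_gt0 e)) m0 (@psi_cont e) (@psi_gap e)). Qed.

Let fI e : finite_set (I e).
Proof. exact: (inner_classes_finite (ltW (ell_gt0 e)) m0 (@psi_cont e) (@psi_gap e)). Qed.

Let rep e (C : set R) : R := xget 0 [set z | nz e z /\ cls e z = C].

Let repP e z : nz e z -> nz e (rep e (cls e z)) /\ cls e (rep e (cls e z)) = cls e z.
Proof.
move=> nzz; exact: (xgetPex 0 (ex_intro (fun y => nz e y /\ cls e y = cls e z) z (conj nzz erefl))).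
Qed.

Let T := {e : edge G & fset_set (K e)}.

Let card_T : #|{: T}| = (\sum_(e : edge G) #|` fset_set (K e)|)%N.
Proof.
by rewrite card_tagged sumnE big_map big_enum/=; apply: eq_bigr => e _; rewrite cardfE.
Qed.

Let g (t : T) : set (graph_space G) := nodal_domain psi (tag t) (rep (tag t) (val (tagged t))).

Let nodal_sub : nodal_domains psi `<=` [set` [fset g t | t in {: T}]%fset].
Proof.
rewrite nodal_domainsE => C [e [x [nzx ->]]].
have xK : cls e x \in fset_set (K e) by rewrite in_fset_set ?inE//; exists x.
apply/imfsetP; exists (existT _ e [` xK]%fset) => //=.
have [nzr Er] := repP nzx; rewrite /g/=.
by apply: nodal_domain_cls => //; have := cls_refl nzr; rewrite Er.
Qed.

(** Rules out the case in which [fset_set] falls back to the empty set and [nodal_count] to 0. *)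
Let nodal_finite : finite_set (nodal_domains psi).
Proof. exact: sub_finite_set nodal_sub (finite_fset _). Qed.

Lemma nodal_count_le : (nodal_count psi <= \sum_(e : edge G) #|` fset_set (K e)|)%N.
Proof.
rewrite -card_T /nodal_count.
apply: (@leq_trans #|` [fset g t | t in {: T}]%fset|).
  apply: fsubset_leq_card; apply/fsubsetP => C; rewrite in_fset_set// inE.
  exact: nodal_sub.
by apply: leq_trans (leq_imfset_card _ _ _) _; rewrite cardE.
Qed.

Lemma nodal_count_ge : (\sum_(e : edge G) #|` fset_set (I e)| <= nodal_count psi)%N.
Proof.
pose TI := {e : edge G & fset_set (I e)}.
have card_TI : #|{: TI}| = (\sum_(e : edge G) #|` fset_set (I e)|)%N.
  by rewrite card_tagged sumnE big_map big_enum/=; apply: eq_bigr => e _; rewrite cardfE.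
pose r e (C : set R) : R := xget 0 [set z | inner e z /\ cls e z = C].
have rP e (C : fset_set (I e)) : inner e (r e (val C)) /\ cls e (r e (val C)) = val C.
  have := valP C; rewrite in_fset_set// inE => -[z iz zC].
  exact: (xgetPex 0 (ex_intro (fun y => inner e y /\ cls e y = val C) z (conj iz zC))).
pose h (t : TI) : set (graph_space G) := nodal_domain psi (tag t) (r (tag t) (val (tagged t))).
have h_inj : injective h.
  move=> [e1 C1] [e2 C2]; rewrite /h/= => E.
  have [i1 E1] := rP _ C1; have [i2 E2] := rP _ C2.
  have [ee c12] := nodal_domain_inj psi_cont i1 i2 E; subst e2.
  congr existT; apply: val_inj; rewrite -E1 -E2; apply/esym/cls_eq => //.
  by case: i1.
rewrite -card_TI /nodal_count.
apply: (@leq_trans #|` [fset h t | t in {: TI}]%fset|).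
  by rewrite card_imfset//= -cardE.
apply: fsubset_leq_card; apply/fsubsetP => C /imfsetP[[e c] _ ->].
rewrite in_fset_set// inE nodal_domainsE; exists e, (r e (val c)); split=> //.
by have [[]] := rP e c.
Qed.

(** On an edge the pulled-back nonzero set agrees with [nz e] except possibly at the two end points,
    since a vertex can be reached through another edge. The exceptional set [N] is null. *)
Lemma graph_measure_nonzero :
  graph_measure NZ = \sum_(e : edge G) fine (lebesgue_measure (nz e)).
Proof.
have nz_sub e : nz e `<=` `[0, ell e]%classic by move=> x [xl _]; rewrite /= in_itv.
have mnz e : measurable (nz e).
  exact: (nz_measurable (ltW (ell_gt0 e)) m0 (@psi_cont e) (@psi_gap e)).
have nzfin e : lebesgue_measure (nz e) \is a fin_num.
  rewrite ge0_fin_numE//; apply: (@le_lt_trans _ _ (lebesgue_measure `[0, ell e]%classic)).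
    by apply: le_measure; rewrite ?inE//; exact: mnz.
  by rewrite lebesgue_measure_itv/= lte_fin ell_gt0 -EFinB ltry.
rewrite /graph_measure sum_fine //.
congr fine; apply: eq_bigr => e _; set S := (X in lebesgue_measure X).
pose N : set R := [set 0; ell e].
have SE : S `\` N = nz e `\` N.
  apply/seteqP; split => x [Sx Nx].
    split=> //; case: Sx => z /= NZz zx; have zl := set_val_itv z.
    rewrite graph_pointE in NZz; rewrite zx in zl NZz.
    split=> //; rewrite -(nonzero_gptE psi)//.
    move: zl => /andP[]; rewrite le_eqVlt => /predU1P[E|->].
      by exfalso; apply: Nx; left.
    by rewrite le_eqVlt => /predU1P[E|->//]; exfalso; apply: Nx; right.
  split=> //; have [xl fx] := Sx; exists (clamp e x); last exact: clampK.
  by rewrite /= graph_pointE clampK//; exact: nonzero_gpt.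
have N0' (A : set R) : A `<=` N -> measurable A /\ lebesgue_measure A = 0%E.
  move=> AN; have cA : countable A.
    by apply: sub_countable (finite_set_countable (finite_set2 0 (ell e))); exact: subset_card_le.
  by split; [exact: countable_measurable|exact: countable_lebesgue_measure0].
have mN : measurable N by have [] := N0' N (fun x => id).
have D (A : set R) : measurable (A `\` N) -> lebesgue_measure A = lebesgue_measure (A `\` N).
  move=> mA; have [mAN AN0] := N0' (A `&` N) (@subIsetr _ A N).
  have dj : (A `&` N) `&` (A `\` N) = set0.
    by apply/seteqP; split => x // [[_ Nx] [_ /(_ Nx)]].
  have := measureU lebesgue_measure mAN mA dj.
  by rewrite setUIDK => ->; rewrite [X in (X + _)%E]AN0 add0e.
have mNZ : measurable (nz e `\` N) by exact: measurableD.
transitivity (lebesgue_measure (nz e `\` N)); last by rewrite -D.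
by rewrite -SE; apply: D; rewrite SE.
Qed.

(** The inner components inject into the nodal domains, and all edgewise components map onto them;
    the two numbers differ by at most 2 on each edge, hence by [2 * E]. *)
Lemma nodal_count_bounds (E := #|edge G|) (M := graph_measure NZ) :
  (nodal_count psi)%:R * m <= M + (2 * E)%:R * m /\
  M <= ((nodal_count psi)%:R + (2 * E)%:R) * d.
Proof.
have nzfin e : lebesgue_measure (nz e) \is a fin_num.
  rewrite ge0_fin_numE//; apply: (@le_lt_trans _ _ (lebesgue_measure `[0, ell e]%classic)).
    apply: le_measure; rewrite ?inE//; last by move=> x [xl _]; rewrite /= in_itv.
    exact: (nz_measurable (ltW (ell_gt0 e)) m0 (@psi_cont e) (@psi_gap e)).
  by rewrite lebesgue_measure_itv/= lte_fin ell_gt0 -EFinB ltry.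
have B e := measure_nz_bounds (ltW (ell_gt0 e)) m0 d0 (@psi_cont e) (@psi_gap e) (@psi_zero e).
have cK e := card_classes (ltW (ell_gt0 e)) m0 (@psi_cont e) (@psi_gap e).
have KI : (\sum_(e : edge G) #|` fset_set (K e)| <= \sum_(e : edge G) #|` fset_set (I e)| + 2 * E)%N.
  apply: leq_trans (leq_sum _ (fun e _ => cK e)) _.
  by rewrite big_split/= sum_nat_const mulnC.
have lo : (\sum_(e : edge G) #|` fset_set (I e)|)%N%:R * m <= M.
  rewrite /M graph_measure_nonzero natr_sum mulr_suml; apply: ler_sum => e _.
  by rewrite -lee_fin fineK//; case/andP: (B e).
have hi : M <= (\sum_(e : edge G) #|` fset_set (K e)|)%N%:R * d.
  rewrite /M graph_measure_nonzero natr_sum mulr_suml; apply: ler_sum => e _.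
  by rewrite -lee_fin fineK//; case/andP: (B e).
have H1 := leq_trans nodal_count_le KI.
have H2 := leq_trans KI (leq_add nodal_count_ge (leqnn _)).
split.
  apply: le_trans (lerD lo (lexx _)); rewrite -mulrDl -natrD.
  by rewrite ler_wpM2r ?(ltW m0)// ler_nat.
by apply: le_trans hi _; rewrite -natrD ler_wpM2r ?(ltW d0)// ler_nat.
Qed.

Lemma graph_measure_le : graph_measure NZ <= total_length G.
Proof.
rewrite graph_measure_nonzero; apply: ler_sum => e _.
have mnz : measurable (nz e).
  exact: (nz_measurable (ltW (ell_gt0 e)) m0 (@psi_cont e) (@psi_gap e)).
have : (lebesgue_measure (nz e) <= (ell e)%:E)%E.
  apply: (@le_trans _ _ (lebesgue_measure `[0, ell e]%classic)).
    by apply: le_measure; rewrite ?inE//; move=> x [xl _]; rewrite /= in_itv.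
  by rewrite lebesgue_measure_itv/= lte_fin ell_gt0 -EFinB subr0.
case: (lebesgue_measure (nz e)) => //=.
by rewrite (ltW (ell_gt0 e)).
Qed.

Lemma graph_measure_ge0 : 0 <= graph_measure NZ.
Proof. by rewrite graph_measure_nonzero; apply: sumr_ge0 => e _; exact: fine_ge0. Qed.

End nodal_counting.

(** * Accumulation points of sequences with null difference *)

Lemma acc_subset (R : realType) (u v : nat -> R) :
  u n - v n @[n --> \oo] --> (0 : R) -> acc u `<=` acc v.
Proof.
move=> uv a [s [s_incr us]]; exists s; split=> //.
have sn n : (n <= s n)%N.
  by elim: n => // n IH; apply: leq_ltn_trans IH _; exact: s_incr.
have s_oo : s n @[n --> \oo] --> \oo.
  by apply/cvgnyPge => A; exists A => // n /= An; exact: leq_trans An (sn n).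
have uvs : u (s n) - v (s n) @[n --> \oo] --> (0 : R).
  exact: (@cvg_comp _ _ _ s (fun n => u n - v n) _ _ _ s_oo uv).
rewrite (_ : (fun n => v (s n)) = (fun n => u (s n) - (u (s n) - v (s n)))).
  by rewrite -[a]subr0; exact: cvgB us uvs.
by apply/funext => n; rewrite opprB addrC subrK.
Qed.

Lemma acc_eq (R : realType) (u v : nat -> R) :
  u n - v n @[n --> \oo] --> (0 : R) -> acc u = acc v.
Proof.
move=> uv; apply/seteqP; split; apply: acc_subset => //.
rewrite (_ : (fun n => v n - u n) = (fun n => - (u n - v n))).
  by rewrite -oppr0; exact: cvgN uv.
by apply/funext => n; rewrite opprB.
Qed.

(** * Weyl's law for square roots and the estimate of the nodal count *)

Section weyl_law.
Context {R : realType} (G : metric_graph R).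
Variables (q : edge G -> R -> R) (B : 'M[R[i]]_#|{: edge G * bool}|).
Variables (w : edge G * bool -> R) (V0 : {set vertex G}).
Hypothesis q_integ : forall e, integ 0 (ell e) (q e).
Hypothesis q_ge0 : forall e,
  {ae lebesgue_measure, forall x, 0 <= x <= ell e -> 0 <= q e x}.
Hypothesis B_hermitian : B \is hermsymmx.
Variables (lambda : nat -> R) (psi : nat -> edge G -> R -> R).
Hypothesis psi_basis : ordered_real_eigenbasis q B w V0 lambda psi.

Local Notation L := (total_length G).
Let E : R := #|edge G|%:R.

(** Without edges all inner products would be empty sums, contradicting that the first eigenfunction
    has norm 1. *)
Lemma total_length_gt0 : 0 < L.
Proof.
have := Psi_orthonormal psi_basis 0 0; rewrite eqxx /dotV /dotR => H.
have [e _] : exists e : edge G, true.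
  apply: contrapT => /forallNP N; move: H; rewrite big1 => [/eqP|e _].
    by rewrite eq_sym oner_eq0.
  by have := N e.
apply: lt_le_trans (ell_gt0 e) _; apply: (@ler_sum_term R _ (@ell _ G)).
by move=> j; rewrite ltW// ell_gt0.
Qed.

Let Lgt0 := total_length_gt0.

(** The step [h] is such that the grid has at most [L / h + 2 E = n] points, one fewer than the
    eigenfunctions that are combined. *)
Lemma weyl_lower_sqrt n : 2 * E < n%:R ->
  pi * ((n%:R - 2 * E) / L) <= Num.sqrt (lambda n).
Proof.
move=> En; pose h := L / (n%:R - 2 * E).
have nE0 : 0 < n%:R - 2 * E by rewrite subr_gt0.
have h0 : 0 < h by rewrite divr_gt0.
have pih : pi * ((n%:R - 2 * E) / L) = pi / h by rewrite /h invf_div.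
rewrite pih -[leLHS]ger0_norm; last by rewrite divr_ge0 ?pi_ge0 ?ltW.
rewrite -sqrtr_sqr ler_wsqrtr//.
apply: (weyl_lower q_integ q_ge0 B_hermitian psi_basis h0).
rewrite ltnS -(ler_nat R) natr_sum.
apply: (@le_trans _ _ (\sum_(e : edge G) (ell e / h + 2))).
  apply: ler_sum => e _; rewrite -addn2 natrD lerD2r truncn_le.
  by rewrite divr_ge0 ?ltW// ell_gt0.
rewrite big_split/= -mulr_suml sumr_const -/(total_length G) -mulr_natl -/E.
by rewrite /h invf_div mulrC divfK ?gt_eqF//; lra.
Qed.

(** With cells of length [1 / X] there are at least [L X - E = n + 1] arches. The resulting bound
    [(pi X)^2 + 2 Q X] is completed to the square of [pi X + Q / pi]. *)
Lemma weyl_upper_sqrt n Q (X := (n.+1%:R + E) / L) : 0 <= Q ->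
  (forall e, Int 0 (ell e) (fun x => `|q e x|) <= Q) ->
  Num.sqrt (lambda n) <= pi * X + Q / pi.
Proof.
move=> Q0 qQ; have E0 : 0 <= E by exact: ler0n.
have X0 : 0 < X by rewrite divr_gt0// ltr_wpDr.
have p0 : 0 < pi :> R := pi_gt0 R.
have Xi : 0 < X^-1 by rewrite invr_gt0.
have H : lambda n <= (pi / X^-1) ^+ 2 + 2 * Q / X^-1.
  apply: (weyl_upper q_integ q_ge0 B_hermitian psi_basis Xi qQ).
  rewrite -(ltr_nat R) natr_sum.
  apply: (@lt_le_trans _ _ (\sum_(e : edge G) (ell e / X^-1 - 1))); last first.
    by apply: ler_sum => e _; rewrite lerBlDr natr1 ltW// truncnS_gt.
  rewrite big_split/= -mulr_suml -/(total_length G) sumr_const -mulr_natl -/E.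
  have LX : L * X = n.+1%:R + E by rewrite /X mulrC divfK ?gt_eqF.
  by rewrite invrK LX -natr1; lra.
have pQ : 0 <= pi * X + Q / pi.
  by apply: addr_ge0; [apply: mulr_ge0|apply: divr_ge0] => //; exact: ltW.
rewrite -[leRHS]ger0_norm// -sqrtr_sqr ler_wsqrtr//; apply: le_trans H _.
have sqE (p Y : R) : p != 0 ->
    (p * Y + Q / p) ^+ 2 = (p * Y) ^+ 2 + 2 * Q * Y + (Q / p) ^+ 2.
  by move=> p1; field.
by rewrite invrK sqE ?lt0r_neq0// lerDl sqr_ge0.
Qed.

(* Consecutive zeros on an edge are at least [pi / sqrt lambda] and at most
   [d] apart, with [1 / d = sqrt lambda / pi - (Q + 1) / pi ^ 2]. *)
Lemma nodal_count_estimate n Q (N := (nodal_count (psi n))%:R)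
    (M := graph_measure (nonzero_set (psi n))) (t := Num.sqrt (lambda n) / pi)
    (c := (Q + 1) / pi ^+ 2) :
  0 <= Q -> (forall e, Int 0 (ell e) (fun x => `|q e x|) <= Q) -> c < t ->
  [/\ 0 <= M <= L, N <= M * t + 2 * E & M * (t - c) <= N + 2 * E].
Proof.
move=> Q0 qQ ct; have p0 : 0 < pi :> R := pi_gt0 R.
have c0 : 0 < c by rewrite divr_gt0 ?exprn_gt0//; lra.
have t0 : 0 < t by exact: lt_trans ct.
have tc0 : 0 < t - c by rewrite subr_gt0.
have s0 : 0 < Num.sqrt (lambda n) by have := t0; rewrite pmulr_lgt0// invr_gt0.
have lam0 : 0 < lambda n by rewrite -sqrtr_gt0.
have lamE : lambda n = (pi * t) ^+ 2.
  by rewrite /t mulrC divfK ?gt_eqF// sqr_sqrtr// ltW.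
have m0 : 0 < t^-1 by rewrite invr_gt0.
have d0 : 0 < (t - c)^-1 by rewrite invr_gt0.
have cont (e : edge G) : {within `[0, ell e], continuous (psi n e)}.
  exact: psi_cont psi_basis n e.
have gp (e : edge G) x y : 0 <= x -> x < y -> y <= ell e -> psi n e x = 0 -> psi n e y = 0 ->
    (exists2 z, x < z < y & psi n e z != 0) -> t^-1 <= y - x.
  move=> x0 xy yl fx fy fz; have yx : 0 < y - x by rewrite subr_gt0.
  have := edge_gap q_integ q_ge0 psi_basis x0 xy yl fx fy fz.
  have n1 : pi / (y - x) \is Num.nneg by rewrite nnegrE divr_ge0 ?(ltW p0) ?(ltW yx).
  have n2 : pi * t \is Num.nneg by rewrite nnegrE mulr_ge0 ?(ltW p0) ?(ltW t0).
  rewrite lamE ler_pXn2r// ler_pM2l// => H.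
  by rewrite -[leRHS]invrK lef_pV2 ?posrE ?invr_gt0.
have zr (e : edge G) x : 0 <= x -> x + (t - c)^-1 <= ell e ->
    exists2 u, x <= u <= x + (t - c)^-1 & psi n e u = 0.
  move=> x0 xd; apply: contrapT => H.
  have f0 u : x <= u <= x + (t - c)^-1 -> psi n e u != 0.
    by move=> xu; apply/eqP => fu; apply: H; exists u.
  have := edge_zero q_integ psi_basis x0 d0 xd (qQ e) f0.
  rewrite lamE !invrK; apply/negP; rewrite -ltNge -subr_gt0.
  (* Substituting this value, the gap in the inequality becomes [Q c + 2 t - c], positive because
     [c < t]. The 1 in [Q + 1] keeps it strict when [Q = 0]. *)
  have cE : c * pi ^+ 2 = Q + 1 by rewrite /c divfK// expf_neq0 ?gt_eqF.
  have cQ := mulr_ge0 Q0 (ltW c0).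
  rewrite (_ : _ - _ = (c * pi ^+ 2) * (2 * t - c) - 2 * Q * (t - c)); last by ring.
  by rewrite cE; lra.
have [H1 H2] := nodal_count_bounds m0 d0 cont gp zr.
split.
- by rewrite (graph_measure_ge0 m0 cont gp) (graph_measure_le m0 cont gp).
- rewrite -(ler_pM2r t0) mulrDl in H1.
  by rewrite !divfK ?gt_eqF// natrM in H1.
- by rewrite -ler_pdivlMr// -[2 * E]natrM.
Qed.

End weyl_law.

(* [psi n] is the eigenfunction number [n.+1]. *)
Theorem proposition3p4 (R : realType) (G : metric_graph R)
  (q : edge G -> R -> R)
  (q_L1 : forall e,
     lebesgue_measure.-integrable (edge_interval e) (EFin \o q e))
  (q_ge0 : forall e,
     {ae lebesgue_measure, forall x, edge_interval e x -> 0 <= q e x})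
  (B : 'M[R[i]]_#|{: edge G * bool}|)
  (B_hermitian : B \is hermsymmx)
  (B_positive : positive_semigroup B)
  (V0 : {set vertex G})
  (w : edge G * bool -> R)
  (w_gt0 : forall i, vtx i \notin V0 -> 0 < w i)
  (lambda : nat -> R) (psi : nat -> edge G -> R -> R)
  (psi_basis : ordered_real_eigenbasis q B w V0 lambda psi) :
  acc (fun n => (nodal_count (psi n))%:R / n.+1%:R : R) =
  acc (fun n => graph_measure (nonzero_set (psi n)) / total_length G).
Proof.
have q_integ e : integ 0 (ell e) (q e) by exact: q_L1.
have q_ge0' e : {ae lebesgue_measure, forall x, 0 <= x <= ell e -> 0 <= q e x}.
  apply: (@filterS _ _ (ae_filter_ringOfSetsType lebesgue_measure)) (q_ge0 e).
  by move=> x qx xe; apply: qx; rewrite /edge_interval/= in_itv.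
apply: acc_eq.
have L0 := total_length_gt0 psi_basis; set L := total_length G in L0 *.
pose E : R := #|edge G|%:R; have E0 : 0 <= E by exact: ler0n.
pose Q : R := \sum_(e : edge G) Int 0 (ell e) (fun x => `|q e x|).
have Qe0 (e : edge G) : 0 <= Int 0 (ell e) (fun x => `|q e x|) by exact: Int_ge0.
have qQ e : Int 0 (ell e) (fun x => `|q e x|) <= Q.
  exact: (@ler_sum_term R _ (fun e => Int 0 (ell e) (fun x => `|q e x|))).
have Q0 : 0 <= Q by exact: sumr_ge0.
have p0 : 0 < pi :> R := pi_gt0 R.
pose c := (Q + 1) / pi ^+ 2.
have c0 : 0 < c by rewrite divr_gt0 ?exprn_gt0//; lra.
pose b := Q / pi ^+ 2.
have b0 : 0 <= b by rewrite divr_ge0 ?exprn_ge0// ltW.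
(* The estimate from above loses at most [3 E + L b] and the one from below at most [4 E + 1 + L c];
   [C] dominates both. *)
pose C := 5 * E + 1 + L * (b + c).
have C0 : 0 <= C by rewrite !addr_ge0 ?mulr_ge0 ?addr_ge0// ltW.
(* The threshold ensures [c < t]: Weyl's lower bound gives [L t >= n - 2 E], which exceeds [L c]. *)
have bound n : 2 * E + L * c < n%:R ->
    `|(nodal_count (psi n))%:R / n.+1%:R
      - graph_measure (nonzero_set (psi n)) / L| <= C * harmonic n.
  move=> nE; have Lc : 0 < L * c by rewrite mulr_gt0.
  have nE2 : 2 * E < n%:R by lra.
  set s := Num.sqrt (lambda n); pose t := s / pi.
  have lo : pi * ((n%:R - 2 * E) / L) <= s.
    exact: (weyl_lower_sqrt q_integ q_ge0' B_hermitian psi_basis nE2).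
  have hi : s <= pi * ((n.+1%:R + E) / L) + Q / pi.
    exact: (weyl_upper_sqrt q_integ q_ge0' B_hermitian psi_basis n Q0 qQ).
  have st : s = pi * t by rewrite /t mulrC divfK// gt_eqF.
  have tlo : n%:R - 2 * E <= L * t.
    move: lo; rewrite st ler_pM2l// ler_pdivrMr// => lo.
    by rewrite [leRHS]mulrC.
  have thi : L * t <= n.+1%:R + E + L * b.
    have H : t <= (n.+1%:R + E) / L + b.
      rewrite -(ler_pM2l p0) -st mulrDr.
      rewrite (_ : pi * b = Q / pi)// /b expr2 invfM mulrCA.
      by rewrite [pi * _]mulrA divff ?mul1r// gt_eqF.
    have := ler_wpM2l (ltW L0) H; rewrite mulrDr.
    by rewrite [L * (_ / L)]mulrC divfK// gt_eqF.
  have ct : c < t by rewrite -(ltr_pM2l L0); lra.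
  have [/andP[M0 ML] H1 H2] :=
    nodal_count_estimate q_integ q_ge0' psi_basis Q0 qQ ct.
  move: H1 H2 M0 ML; set N := (nodal_count _)%:R; set M := graph_measure _.
  rewrite -/L -/c -[Num.sqrt _ / pi]/t -/E => H1 H2 M0 ML.
  (* The errors in Weyl's law reach the nodal count multiplied by this fraction; as it lies in
     [[0, 1]], they stay bounded uniformly in [n]. *)
  pose y := M / L; have yM : M = y * L by rewrite /y divfK// gt_eqF.
  have y0 : 0 <= y by rewrite divr_ge0// ltW.
  have y1 : y <= 1 by rewrite ler_pdivrMr// mul1r.
  have n1 : 0 < n.+1%:R :> R by exact: ltr0n.
  rewrite -/y /harmonic -[X in `|X|](mulfK (lt0r_neq0 n1)) normrM.
  rewrite (@gtr0_norm _ n.+1%:R^-1) ?invr_gt0// ler_pM2r ?invr_gt0//.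
  rewrite mulrBl divfK ?lt0r_neq0// ler_norml.
  have nS : n.+1%:R = n%:R + 1 :> R by rewrite natr1.
  have Lc0 := mulr_ge0 (ltW L0) (ltW c0).
  have Lb0 := mulr_ge0 (ltW L0) b0.
  have Mt : M * t = y * (L * t) by rewrite yM; ring.
  have Mc : M * c = y * (L * c) by rewrite yM; ring.
  have k1 : y * (L * t) <= y * (n.+1%:R + E + L * b) by rewrite ler_wpM2l.
  have k2 : y * (n%:R - 2 * E) <= y * (L * t) by rewrite ler_wpM2l.
  have k3 : y * (L * c) <= L * c by rewrite ler_piMl.
  have k4 : y * (L * b) <= L * b by rewrite ler_piMl.
  have k5 : y * E <= E by rewrite ler_piMl.
  rewrite mulrBr Mt Mc in H2; rewrite Mt in H1; rewrite nS in k1 *.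
  rewrite /C; apply/andP; split; lra.
have hC0 : C * harmonic n @[n --> \oo] --> (0 : R).
  by rewrite -[X in _ --> X](mulr0 C); apply: cvgMr; exact: cvg_harmonic.
have hC0N : - (C * harmonic n) @[n --> \oo] --> (0 : R).
  by rewrite -oppr0; exact: cvgN hC0.
apply: (squeeze_cvgr _ hC0N hC0).
exists (Num.trunc (2 * E + L * c)).+1 => // n /= nn.
rewrite -ler_norml; apply: bound.
by apply: lt_le_trans (truncnS_gt _) _; rewrite ler_nat.
Qed.
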